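(* Let $P\mapsto R_P$ and $P\mapsto S_P$ belong to the class $\mathcal{S}$, and let $\mathrm{Rem}_P^\Psi= P_0^2\Gamma_P-\psi_0$. There is a constant $C>0$ not depending on $P$ such that, for each $P\in\mathcal{M}$: (a) if $R_0(O)\overset{d}{=}S_0(O)$ under $P_0$, then $$|\mathrm{Rem}_P^{\Psi}|\le C\,K_{0P},\qquad K_{0P}\triangleq \|L_P^{RS}\|_{2,P_0}\|M_P^{RS}\|_{2,P_0}+\|L_P^{RS}\|_{1,P_0}^2+\|M_P^{RS}\|_{4,P_0}^4;$$ (b) if $R_0(O)$ and $S_0(O)$ are not equal in distribution under $P_0$, then $$|\mathrm{Rem}_P^{\Psi}|\le C\,K_{1P},\qquad K_{1P}\triangleq \|L_P^{RS}\|_{1,P_0}+\|M_P^{RS}\|_{2,P_0}^2 .$$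
   Context: Model and parameters. $\mathcal{M}$ is the nonparametric model of distributions for an observation $O$ taking values in $\mathcal{O}$. $P_0\in\mathcal{M}$ is the true distribution. $P\mapsto R_P$ and $P\mapsto S_P$ map $\mathcal{M}$ into bounded real-valued measurable functions on $\mathcal{O}$. A subscript $0$ denotes evaluation at $P_0$ (e.g. $R_0=R_{P_0}$). For mappings $T,U$ of this type, $$\Phi^{TU}(P)\triangleq\iint e^{-[T_P(o_1)-U_P(o_2)]^2}dP(o_1)dP(o_2),\qquad \Psi(P)\triangleq\Phi^{RR}(P)-2\Phi^{RS}(P)+\Phi^{SS}(P),\qquad \psi_0\triangleq\Psi(P_0).$$ Class $\mathcal{S}$: all mappings $T$ for which there is a measurable function $X^T$ on $\mathcal{O}$ (write $x^T=X^T(o)$, and $T_P(o)=T_P(x^T)$) such that: (S1) $T_P$ is a measurable mapping with domain $\{X^T(o):o\in\mathcal{O}\}$ and range contained in $[-b,b]$ for some $0\le b<\infty$ independent of $P$; (S2) for all submodels $dP_t/dP=1+th$ with bounded $h$, $Ph=0$, there exist $\delta>0$ and a set $\mathcal{O}_1\subseteq\mathcal{O}$ with $P_0(\mathcal{O}_1)=1$ such that for all $(o,t_1)\in\mathcal{O}_1\times(-\delta,\delta)$, $t\mapsto T_{P_t}(x^T)$ is twice differentiable at $t_1$ with first and second derivatives uniformly bounded (in $x^T$); (S3) for any $P\in\mathcal{M}$ and submodel $dP_t/dP=1+th$ with bounded $h$, $Ph=0$, there is a function $D_P^T:\mathcal{O}\to\mathbb{R}$ (depending on $T$ and $P$, not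 on $h$, as the notation indicates), uniformly bounded in $P$ and $o$, such that $\int D_P^T(o)\,dP(o|x^T)=0$ for almost all $o\in\mathcal{O}$ and $\frac{d}{dt}T_{P_t}(x^T)|_{t=0}=\int D_P^T(o)h(o)\,dP(o|x^T)$, where $P(\cdot|x^T)$ is the conditional distribution of $O$ given $X^T=x^T$ under $P$. For $T,U\in\mathcal{S}$, $$\Gamma_P^{TU}(o_1,o_2)\triangleq\Big[2[T_P(o_1)-U_P(o_2)][D_P^U(o_2)-D_P^T(o_1)]+1-\{4[T_P(o_1)-U_P(o_2)]^2-2\}D_P^T(o_1)D_P^U(o_2)\Big]e^{-[T_P(o_1)-U_P(o_2)]^2},$$ $\Gamma_P\triangleq\Gamma_P^{RR}-\Gamma_P^{RS}-\Gamma_P^{SR}+\Gamma_P^{SS}$, and $P_0^2\Gamma_P=\iint\Gamma_P\,dP_0dP_0$. The remainder is originally defined as $\mathrm{Rem}_P^\Psi\triangleq\Psi(P)-\Psi(P_0)-(P-P_0)D_1^\Psi(P)+\tfrac12(P-P_0)^2D_2^\Psi(P)$ with $D_1^\Psi(P)(o)=2[\int\Gamma_P(o,o_2)dP(o_2)-\Psi(P)]$ and $D_2^\Psi(P)=2\Gamma_P$; it equals $P_0^2\Gamma_P-\psi_0$. For $T\in\mathcal{S}$, $\mathrm{Rem}_P^T(o)\triangleq T_P(o)-T_0(o)+\int D_P^T(o_1)[dP_0(o_1|x^T)-dP(o_1|x^T)]$. Further $L_P^{RS}(o)\triangleq\max\{|\mathrm{Rem}_P^R(o)|,|\mathrm{Rem}_P^S(o)|\}$,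 $M_P^{RS}(o)\triangleq\max\{|R_P(o)-R_0(o)|,|S_P(o)-S_0(o)|\}$, and $\|f\|_{p,P_0}\triangleq[\int|f(o)|^pdP_0(o)]^{1/p}$. *)

(* Defs.v *)
From HB Require Import structures.
From mathcomp Require Import all_boot all_order all_algebra.
From mathcomp Require Import all_classical all_reals all_analysis.

Set Implicit Arguments.
Unset Strict Implicit.
Unset Printing Implicit Defensive.

Import Order.TTheory GRing.Theory Num.Theory.
Import numFieldNormedType.Exports.

Local Open Scope classical_set_scope.
Local Open Scope ring_scope.

Definition bounded_score d (O : measurableType d) (R : realType)
    (P : probability O R) (h : O -> R) : Prop :=
  [/\ measurable_fun [set: O] h,
      exists c : R, forall o, `|h o| <= c &
      \int[P]_o h o = 0].

(* [Q] is a path with dQ_t/dP = 1 + t h. The density is only nonnegative for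
   [t] near 0, so nothing is asked of [Q t] for the other values of [t]. *)
Definition submodel d (O : measurableType d) (R : realType)
    (M : set (probability O R)) (P : probability O R) (h : O -> R)
    (Q : R -> probability O R) : Prop :=
  exists2 e : R, 0 < e &
    forall t, `|t| < e ->
      M (Q t) /\
      forall A, measurable A -> Q t A = (\int[P]_(o in A) (1 + t * h o)%:E)%E.

(* A nonparametric model leaves the bounded scores unrestricted. The set of all
   probability measures on [O] is the largest example. *)
Definition nonparametric d (O : measurableType d) (R : realType)
    (M : set (probability O R)) : Prop :=
  forall P h, M P -> bounded_score P h -> exists Q, submodel M P h Q.

(* Measurability of a function with domain [A], for the trace on [A] of the
   sigma-algebra of [X]. Unlike in [measurable_fun A f], the set [A] need not
   be measurable; it will be the range of a measurable function. *)
Definition trace_measurable_fun d (X : measurableType d) (R : realType)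
    (A : set X) (f : X -> R) : Prop :=
  forall Y : set R, measurable Y ->
    exists2 B : set X, measurable B & A `&` f @^-1` Y = A `&` B.

(* [k] is a regular version of the conditional distribution under [P] of the
   observation given [XT]. *)
Definition is_cond_dist d (O : measurableType d) d' (X : measurableType d')
    (R : realType) (P : probability O R) (XT : O -> X)
    (k : R.-pker X ~> O) : Prop :=
  forall (A : set O) (B : set X), measurable A -> measurable B ->
    P (A `&` XT @^-1` B) = (\int[P]_(o in XT @^-1` B) k (XT o) A)%E.

(* Membership of [T] in the class S. The conditional distributions given [XT]
   and the function D^T are part of the structure because the objects defined
   below depend on them. [cS_val P] is T_P seen as a function of x^T; only its
   values on the range of [cS_fun] matter. Conditional distributions being
   determined up to null sets only, a version is fixed for every [P]. As in
   [cS_S2], "almost all" refers to [P0] in [cS_S3_center] and [cS_S3_deriv]. *)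
Record class_S d (O : measurableType d) (R : realType)
    (M : set (probability O R)) (P0 : probability O R)
    (T : probability O R -> O -> R) := ClassS {
  cS_disp : measure_display;
  cS_space : measurableType cS_disp;
  cS_fun : O -> cS_space;
  cS_val : probability O R -> cS_space -> R;
  cS_cond : probability O R -> R.-pker cS_space ~> O;
  cS_D : probability O R -> O -> R;
  cS_fun_measurable : measurable_fun [set: O] cS_fun;
  cS_valE : forall P o, M P -> T P o = cS_val P (cS_fun o);
  cS_condP : forall P, M P -> is_cond_dist P cS_fun (cS_cond P);
  cS_S1_measurable : forall P, M P ->
    trace_measurable_fun (range cS_fun) (cS_val P);
  cS_S1_bounded : exists2 b : R, 0 <= b &
    forall P x, M P -> range cS_fun x -> - b <= cS_val P x <= b;
  cS_S2 : forall P h Q, M P -> bounded_score P h -> submodel M P h Q ->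
    exists2 delta : R, 0 < delta &
    exists O1 : set O, [/\ measurable O1, P0 O1 = 1%E &
      forall t1 : R, - delta < t1 < delta ->
      let f o := (fun t : R => cS_val (Q t) (cS_fun o)) in
      (forall o, O1 o ->
        derivable (f o) t1 1 /\ derivable (derive1 (f o)) t1 1) /\
      (exists c : R, forall o, O1 o ->
        `|derive1 (f o) t1| <= c /\ `|derive1n 2 (f o) t1| <= c)];
  cS_D_measurable : forall P, M P -> measurable_fun [set: O] (cS_D P);
  cS_D_bounded : exists c : R, forall P o, M P -> `|cS_D P o| <= c;
  cS_S3_center : forall P, M P ->
    {ae P0, forall o, \int[cS_cond P (cS_fun o)]_o1 cS_D P o1 = 0};
  cS_S3_deriv : forall P h Q, M P -> bounded_score P h -> submodel M P h Q ->
    {ae P0, forall o,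
      is_derive (0 : R) (1 : R)
        (fun t : R => cS_val (Q t) (cS_fun o))
        (\int[cS_cond P (cS_fun o)]_o1 (cS_D P o1 * h o1))}
}.

Definition Phi d (O : measurableType d) (R : realType)
    (T U : probability O R -> O -> R) (P : probability O R) : R :=
  \int[P]_o1 \int[P]_o2 expR (- (T P o1 - U P o2) ^+ 2).

Definition Psi d (O : measurableType d) (R : realType)
    (T U : probability O R -> O -> R) (P : probability O R) : R :=
  Phi T T P - 2 * Phi T U P + Phi U U P.

Definition Gamma2 d (O : measurableType d) (R : realType)
    (M : set (probability O R)) (P0 : probability O R)
    (T U : probability O R -> O -> R)
    (cT : class_S M P0 T) (cU : class_S M P0 U)
    (P : probability O R) (o1 o2 : O) : R :=
  (2 * (T P o1 - U P o2) * (cS_D cU P o2 - cS_D cT P o1) + 1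
   - (4 * (T P o1 - U P o2) ^+ 2 - 2) * cS_D cT P o1 * cS_D cU P o2)
  * expR (- (T P o1 - U P o2) ^+ 2).

Definition Gamma d (O : measurableType d) (R : realType)
    (M : set (probability O R)) (P0 : probability O R)
    (T U : probability O R -> O -> R)
    (cT : class_S M P0 T) (cU : class_S M P0 U)
    (P : probability O R) (o1 o2 : O) : R :=
  Gamma2 cT cT P o1 o2 - Gamma2 cT cU P o1 o2
  - Gamma2 cU cT P o1 o2 + Gamma2 cU cU P o1 o2.

Definition Rem_Psi d (O : measurableType d) (R : realType)
    (M : set (probability O R)) (P0 : probability O R)
    (T U : probability O R -> O -> R)
    (cT : class_S M P0 T) (cU : class_S M P0 U) (P : probability O R) : R :=
  \int[P0]_o1 \int[P0]_o2 Gamma cT cU P o1 o2 - Psi T U P0.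

Definition Rem d (O : measurableType d) (R : realType)
    (M : set (probability O R)) (P0 : probability O R)
    (T : probability O R -> O -> R) (cT : class_S M P0 T)
    (P : probability O R) (o : O) : R :=
  T P o - T P0 o
  + (\int[cS_cond cT P0 (cS_fun cT o)]_o1 cS_D cT P o1
     - \int[cS_cond cT P (cS_fun cT o)]_o1 cS_D cT P o1).

Definition L d (O : measurableType d) (R : realType)
    (M : set (probability O R)) (P0 : probability O R)
    (T U : probability O R -> O -> R)
    (cT : class_S M P0 T) (cU : class_S M P0 U)
    (P : probability O R) (o : O) : R :=
  Num.max `|Rem cT P o| `|Rem cU P o|.

Definition Mdiff d (O : measurableType d) (R : realType)
    (P0 : probability O R) (T U : probability O R -> O -> R)
    (P : probability O R) (o : O) : R :=
  Num.max `|T P o - T P0 o| `|U P o - U P0 o|.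

Definition norm_p d (O : measurableType d) (R : realType)
    (P0 : probability O R) (p : R) (f : O -> R) : \bar R :=
  ('N[P0]_(p%:E)[EFin \o f])%E.

Definition K0 d (O : measurableType d) (R : realType)
    (M : set (probability O R)) (P0 : probability O R)
    (T U : probability O R -> O -> R)
    (cT : class_S M P0 T) (cU : class_S M P0 U)
    (P : probability O R) : \bar R :=
  (norm_p P0 2 (L cT cU P) * norm_p P0 2 (Mdiff P0 T U P)
   + norm_p P0 1 (L cT cU P) ^+ 2 + norm_p P0 4 (Mdiff P0 T U P) ^+ 4)%E.

Definition K1 d (O : measurableType d) (R : realType)
    (M : set (probability O R)) (P0 : probability O R)
    (T U : probability O R -> O -> R)
    (cT : class_S M P0 T) (cU : class_S M P0 U)
    (P : probability O R) : \bar R :=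
  (norm_p P0 1 (L cT cU P) + norm_p P0 2 (Mdiff P0 T U P) ^+ 2)%E.

Definition eq_in_distribution d (O : measurableType d) (R : realType)
    (P : probability O R) (f g : O -> R) : Prop :=
  forall A : set R, measurable A -> pushforward P f A = pushforward P g A.

(* Main.v *)
Require Import Defs.
From mathcomp Require Import all_boot all_order all_algebra.
From mathcomp Require Import all_classical all_reals all_analysis.
From mathcomp Require Import measurable_realfun.
From mathcomp Require Import ring lra.

(** Under P_0 x P_0 the function D_P^T may be replaced, in the integral of
    Gamma_P^TU, by its conditional mean given x^T, and this conditional mean is
    Rem_P^T - (T_P - T_0) because the conditional mean under P vanishes. With
    f(u) = exp(-u^2), u = T_P(o_1) - U_P(o_2) and d^T, d^U the conditional
    means, Gamma_P^TU becomes f(u) - f'(u)(d^U - d^T) - f''(u) d^T d^U, to be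
    compared with f at u_0 = T_0(o_1) - U_0(o_2).

    Since u - u_0 = (T_P - T_0)(o_1) - (U_P - U_0)(o_2), a first order Taylor
    expansion gives (b), whatever the laws of R_0 and S_0. For (a), expand to
    third order: up to terms bounded by K_0P, only f(u_0) and products of a
    derivative of f at u_0 with a function of a single observation remain.
    Summed with signs over T, U in {R, S}, these products integrate to zero
    when R_0 and S_0 have the same law. *)

Set Implicit Arguments.
Unset Strict Implicit.
Unset Printing Implicit Defensive.

Import Order.TTheory GRing.Theory Num.Theory.
Import numFieldNormedType.Exports.

Local Open Scope classical_set_scope.
Local Open Scope ring_scope.

(** * Taylor expansion of the Gaussian kernel *)

Section taylor.
Variable R : realType.
Implicit Types (x h B : R).

(** One mean value theorem between [0] and [h], on either side of [0]; each use raises the order of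
    a Taylor remainder by one. *)
Lemma le_norm_MVT (F dF : R -> R) h B (n : nat) :
  (forall s, is_derive s (1 : R) F (dF s)) -> F 0 = 0 ->
  (forall s, `|dF s| <= B * `|s| ^+ n) -> 0 <= B ->
  `|F h| <= B * `|h| ^+ n.+1.
Proof.
move=> dF' F0 dFB B0.
have cF : continuous F.
  move=> s; apply: differentiable_continuous; apply/derivable1_diffP.
  exact: (@ex_derive _ _ _ _ _ _ _ (dF' s)).
have bound c : `|c| <= `|h| -> `|dF c * h| <= B * `|h| ^+ n.+1.
  move=> ch; rewrite normrM exprSr mulrA ler_wpM2r//.
  by rewrite (le_trans (dFB c))// ler_wpM2l// lerXn2r// nnegrE.
have [h0|h0] := leP 0 h.
- have [c] := @MVT_segment R F dF 0 h h0 (fun s _ => dF' s)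
    (continuous_subspaceT cF).
  rewrite in_itv/= F0 !subr0 => /andP[c0 ch] ->; apply: bound.
  by rewrite !ger0_norm.
- have [c] := @MVT_segment R F dF h 0 (ltW h0) (fun s _ => dF' s)
    (continuous_subspaceT cF).
  rewrite in_itv/= F0 !sub0r => /andP[c0 ch] /eqP.
  rewrite mulrN eqr_opp => /eqP ->; apply: bound.
  by rewrite !ler0_norm// ?lerN2// ltW.
Qed.

(** Differentiated in the increment, the remainder of order [n.+1] is the remainder of order [n] for
    the shifted sequence [fun k => g k.+1]. The factor 1/n! is given up in the bound. *)
Lemma taylor_le (n : nat) (g : nat -> R -> R) x h B :
  (forall k y, (k < n)%N -> is_derive y (1 : R) (g k) (g k.+1 y)) ->
  (forall y, `|g n y| <= B) ->
  `|g 0%N (x + h) - \sum_(k < n) g k x * (h ^+ k / k`!%:R)| <= B * `|h| ^+ n.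
Proof.
move=> + gB; have B0 : 0 <= B by exact: le_trans (gB 0).
elim: n g gB h => [|n IH] g gB h dg.
  by rewrite big_ord0 subr0 expr0 mulr1.
pose F s := g 0%N (x + s) - \sum_(k < n.+1) g k x * (s ^+ k / k`!%:R).
pose dF s := g 1%N (x + s) - \sum_(k < n) g k.+1 x * (s ^+ k / k`!%:R).
apply: (@le_norm_MVT F dF) => //.
- move=> s.
  have -> : F = (g 0%N \o +%R x) -
      \sum_(k < n.+1) (fun s => g k x * (s ^+ k / k`!%:R)).
    by apply/funext => t; rewrite /F !fctE fct_sumE.
  apply: is_deriveB.
    have H0 : is_derive s (1 : R) (+%R x) 1.
      have -> : +%R x = shift x by apply/funext => t; rewrite /= addrC.
      exact: is_derive_shift.
    rewrite -[X in is_derive _ _ _ X]mulr1.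
    exact: (@is_derive1_comp _ _ _ _ _ _ (dg 0%N (x + s) isT) H0).
  have H (k : 'I_n.+1) : is_derive s (1 : R)
      (fun s : R => g k x * (s ^+ k / k`!%:R))
      (g k x * (k%:R * s ^+ k.-1 / k`!%:R)).
    have -> : (fun s : R => g k x * (s ^+ k / k`!%:R)) =
        (g k x / k`!%:R) \*: (@id R) ^+ k.
      by apply/funext => t; rewrite !fctE /= /GRing.scale/=; ring.
    apply: is_derive_eq; rewrite /GRing.scale/= mulr1; ring.
  apply: (is_derive_eq (is_derive_sum H)).
  rewrite big_ord_recl /= !mul0r mulr0 add0r; apply: eq_bigr => k _.
  rewrite /bump/= add1n factS natrM; congr (_ * _).
  have k0 : k`!%:R != 0 :> R by rewrite pnatr_eq0 -lt0n fact_gt0.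
  have k1 : 1 + k%:R != 0 :> R by rewrite nat1r pnatr_eq0.
  by field; rewrite k0 k1.
- rewrite /F /= addr0 big_ord_recl big1 => [|i _].
    by rewrite expr0 divr1 mulr1 addr0 subrr.
  by rewrite expr0n/= mul0r mulr0.
- move=> s; apply: (IH (fun k => g k.+1)) => // k y kn.
  exact: dg.
Qed.
End taylor.

(** * Derivatives of exp(-u^2) and pointwise expansions of the kernel of Gamma *)

Section gauss.
Variable R : realType.
Implicit Types (u a b r s x h : R).

(* The [k]-th derivative of [u |-> exp (- u ^ 2)] for [k <= 4] (for [k > 4],
   still the fourth one). *)
Definition gaussD (k : nat) (u : R) : R :=
  match k with
  | 0 => 1
  | 1 => - 2 * u
  | 2 => 4 * u ^+ 2 - 2
  | 3 => - 8 * u ^+ 3 + 12 * u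
  | _ => 16 * u ^+ 4 - 48 * u ^+ 2 + 12
  end * expR (- u ^+ 2).

Lemma is_derive_gaussD k u : (k < 4)%N ->
  is_derive u (1 : R) (gaussD k) (gaussD k.+1 u).
Proof.
have dexp : is_derive u (1 : R) (expR \o (- (@id R ^+ 2)))
    (expR (- u ^+ 2) * (- (2 * u))).
  apply: is_derive1_comp.
  by apply: is_derive_eq; rewrite /GRing.scale/=; ring.
(* The derivative of p(u) exp(-u^2) is (p' - 2 u p) exp(-u^2), so each case becomes an identity
   between polynomials. *)
have key (p : R -> R) (dp q : R) :
    is_derive u (1 : R) p dp -> dp - 2 * u * p u = q ->
    is_derive u (1 : R) (fun u => p u * expR (- u ^+ 2)) (q * expR (- u ^+ 2)).
  move=> pd <-.
  have -> : (fun u => p u * expR (- u ^+ 2)) =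
      p * (expR \o (- (@id R ^+ 2))) by [].
  apply: (is_derive_eq (is_deriveM pd dexp)).
  by rewrite /GRing.scale/= !fctE; ring.
case: k => [|[|[|[|//]]]] _.
- apply: (key (cst 1) 0).
  by rewrite /=; ring.
- apply: (key (fun u => -2 * u) (-2)); last by ring.
  have -> : (fun u => -2 * u) = -2 \*: (@id R) by [].
  by apply: is_derive_eq; rewrite /GRing.scale/=; ring.
- apply: (key (fun u => 4 * u ^+ 2 - 2) (8 * u)); last by ring.
  have -> : (fun u => 4 * u ^+ 2 - 2) = 4 \*: (@id R) ^+ 2 - cst 2 by [].
  by apply: is_derive_eq; rewrite /GRing.scale/=; ring.
- apply: (key (fun u => - 8 * u ^+ 3 + 12 * u) (-24 * u ^+ 2 + 12));
    last by ring.
  have -> : (fun u => - 8 * u ^+ 3 + 12 * u) =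
    -8 \*: (@id R) ^+ 3 + 12 \*: (@id R) by [].
  by apply: is_derive_eq; rewrite /GRing.scale/=; ring.
Qed.

(** Since exp(u^2) = exp(u^2/2)^2 is at least (1 + u^2/2)^2, it suffices to compare the polynomial
    factors with 64 (1 + u^2/2)^2, whose leading coefficient 64/4 is exactly the 16 of the fourth
    derivative. *)
Lemma normr_gaussD_le k u : `|gaussD k u| <= 64.
Proof.
have key p : `|p| <= 64 * (1 + u ^+ 2 / 2) ^+ 2 -> `|p * expR (- u ^+ 2)| <= 64.
  move=> hp; rewrite normrM (ger0_norm (expR_ge0 _)) expRN.
  rewrite ler_pdivrMr ?expR_gt0//.
  apply: le_trans hp _; rewrite ler_pM2l//.
  have -> : u ^+ 2 = u ^+ 2 / 2 + u ^+ 2 / 2 by field.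
  rewrite expRD -expr2 -splitr lerXn2r ?nnegrE ?expR_ge0 ?expR_ge1Dx//.
  by rewrite addr_ge0// divr_ge0// sqr_ge0.
have u2 := sqr_ge0 u; have u4 := sqr_ge0 (u ^+ 2).
have v1 := sqr_ge0 (u - 1); have v2 := sqr_ge0 (u + 1).
case: k => [|[|[|[|k]]]]; apply: key; rewrite ler_norml; apply/andP; split;
  try lra.
(* The two sides of the cubic case remain; 2 |u|^3 <= u^4 + u^2 settles them. *)
- have := sqr_ge0 (u ^+ 2 - u); lra.
- have := sqr_ge0 (u ^+ 2 + u); lra.
Qed.

Lemma measurable_gaussD k : measurable_fun [set: R] (gaussD k).
Proof.
apply: measurable_funM.
  by case: k => [|[|[|[|k]]]] //; repeat first
    [exact: measurable_cst|exact: measurable_id|apply: measurable_funX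
    |apply: measurable_funM|apply: measurable_funB|apply: measurable_funD].
apply: (measurableT_comp (@measurable_expR R)); apply: measurable_funN.
exact: measurable_funX.
Qed.

Lemma gaussD0N u : gaussD 0 (- u) = gaussD 0 u.
Proof. by rewrite /gaussD sqrrN. Qed.

Lemma gauss_taylor k n x h : (k + n <= 4)%N ->
  `|gaussD k (x + h) - \sum_(i < n) gaussD (k + i) x * (h ^+ i / i`!%:R)|
    <= 64 * `|h| ^+ n.
Proof.
move=> kn.
have := @taylor_le R n (fun i => gaussD (k + i)) x h 64.
rewrite addn0; apply => [i y ni|y]; last exact: normr_gaussD_le.
by rewrite addnS; apply: is_derive_gaussD; apply: leq_trans kn;
  rewrite ltn_add2l.
Qed.


(** The kernel of Gamma^TU at u = T_P(o_1) - U_P(o_2), with [d1], [d2] for the values of D^T, D^U;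
    its polynomial factors are those of the first two Gaussian derivatives. *)
Definition gammaD (u d1 d2 : R) : R :=
  gaussD 0 u - gaussD 1 u * (d2 - d1) - gaussD 2 u * d1 * d2.

(** With f(u) = exp(-u^2), h = a - b and u = x + h, the part f(u) - f'(u) h is the Taylor polynomial
    at u evaluated at x, so it misses f(x) by O(h^2). Every other term contains r, s or the product
    a b; [K] reduces products such as r s to first order. *)
Lemma gammaD_first_order K x a b r s L1 L2 M1 M2 : 1 <= K ->
  `|r| <= L1 -> `|s| <= L2 -> `|a| <= M1 -> `|b| <= M2 ->
  L1 <= K -> L2 <= K -> M1 <= K -> M2 <= K ->
  `|gammaD (x + (a - b)) (r - a) (s - b) - gaussD 0 x| <=
    256 * K * (L1 + L2 + (M1 ^+ 2 + M2 ^+ 2)).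
Proof.
move=> K1 rL sL aM bM LK1 LK2 MK1 MK2.
set h := a - b; set u := x + h.
have L10 : 0 <= L1 by apply: le_trans rL.
have L20 : 0 <= L2 by apply: le_trans sL.
have M10 : 0 <= M1 by apply: le_trans aM.
have M20 : 0 <= M2 by apply: le_trans bM.
have hM : `|h| ^+ 2 <= 2 * (M1 ^+ 2 + M2 ^+ 2).
  have : `|h| <= M1 + M2 by apply: le_trans (ler_normB _ _) _; exact: lerD.
  have := sqr_ge0 (M1 - M2); have := normr_ge0 h; nra.
have t1 : `|gaussD 0 x - (gaussD 0 u - gaussD 1 u * h)| <= 64 * `|h| ^+ 2.
  have := @gauss_taylor 0 2 u (- h) isT.
  rewrite !big_ord_recl big_ord0/= /u addrK normrN.
  by rewrite !add0n expr0 expr1 !factS fact0 !divr1 mulr1 addr0 mulrN.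
have t2 : `|gaussD 1 u * (s - r)| <= 64 * (L2 + L1).
  rewrite normrM; apply: ler_pM => //; first exact: normr_gaussD_le.
  by apply: le_trans (ler_normB _ _) _; exact: lerD.
have t3 : `|gaussD 2 u * ((r - a) * (s - b))| <=
    64 * (L1 * (2 * K) + (M1 * L2 + M1 * M2)).
  rewrite normrM; apply: ler_pM => //; first exact: normr_gaussD_le.
  have -> : (r - a) * (s - b) = r * (s - b) - (a * s - a * b) by ring.
  apply: le_trans (ler_normB _ _) _; apply: lerD.
    rewrite normrM; apply: ler_pM => //.
    by apply: le_trans (ler_normB _ _) _; lra.
  by apply: le_trans (ler_normB _ _) _; rewrite !normrM lerD// ler_pM.
have -> : gammaD u (r - a) (s - b) - gaussD 0 x =
    - (gaussD 0 x - (gaussD 0 u - gaussD 1 u * h)) - gaussD 1 u * (s - r) -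
    gaussD 2 u * ((r - a) * (s - b)) by rewrite /gammaD /h; ring.
apply: le_trans (ler_normB _ _) _; apply: le_trans (lerD (ler_normB _ _) t3) _.
rewrite normrN; apply: le_trans (lerD (lerD t1 t2) (lexx _)) _.
have M12 : M1 * M2 <= M1 ^+ 2 + M2 ^+ 2 by have := sqr_ge0 (M1 - M2); nra.
have ML : M1 * L2 <= K * L2 by rewrite ler_wpM2r.
have KL1 : L1 <= K * L1 by rewrite ler_peMl.
have KL2 : L2 <= K * L2 by rewrite ler_peMl.
have KM : M1 ^+ 2 + M2 ^+ 2 <= K * (M1 ^+ 2 + M2 ^+ 2).
  by rewrite ler_peMl// addr_ge0// sqr_ge0.
have := mulr_ge0 L10 (le_trans ler01 K1).
have := mulr_ge0 L20 (le_trans ler01 K1).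
have := addr_ge0 (sqr_ge0 M1) (sqr_ge0 M2).
lra.
Qed.

(* With [d1 = r - a] and [d2 = s - b], the mixed products of [a] and [b] of
   order two and three cancel, so that each bracket involves the increment and
   the remainder at one observation only. *)
Definition gammaD_expansion (x a b r s : R) : R :=
  gaussD 0 x
  + (gaussD 1 x * r - gaussD 2 x * (a ^+ 2 / 2) - gaussD 3 x * (a ^+ 3 / 3))
  - (gaussD 1 x * s + gaussD 2 x * (b ^+ 2 / 2) - gaussD 3 x * (b ^+ 3 / 3)).

(** Expand f(u), f'(u) and f''(u) at x to degrees 3, 2 and 1. Among the terms free of r and s, f'(x)
    has coefficient h - h = 0, f''(x) has -h^2/2 - ab = -(a^2 + b^2)/2 and f'''(x) has -h^3/3 - abh
    = -(a^3 - b^3)/3. *)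
Lemma gammaD_third_order x a b r s L1 L2 M1 M2 :
  `|r| <= L1 -> `|s| <= L2 -> `|a| <= M1 -> `|b| <= M2 ->
  `|gammaD (x + (a - b)) (r - a) (s - b) - gammaD_expansion x a b r s| <=
    2048 * ((L1 + L2) * (M1 + M2) + L1 * L2 + (M1 ^+ 4 + M2 ^+ 4)).
Proof.
move=> rL sL aM bM.
set h := a - b; set u := x + h.
have L10 : 0 <= L1 by apply: le_trans rL.
have L20 : 0 <= L2 by apply: le_trans sL.
have M10 : 0 <= M1 by apply: le_trans aM.
have M20 : 0 <= M2 by apply: le_trans bM.
have hM : `|h| <= M1 + M2 by apply: le_trans (ler_normB _ _) _; exact: lerD.
have M4 : M1 ^+ 4 + M2 ^+ 4 = (M1 ^+ 2) ^+ 2 + (M2 ^+ 2) ^+ 2 by ring.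
have h2 : `|h| ^+ 2 <= 2 * (M1 ^+ 2 + M2 ^+ 2).
  have := sqr_ge0 (M1 - M2); have := normr_ge0 h; nra.
have h4 : `|h| ^+ 4 <= 8 * (M1 ^+ 4 + M2 ^+ 4).
  have -> : `|h| ^+ 4 = (`|h| ^+ 2) ^+ 2 by ring.
  have := sqr_ge0 (M1 ^+ 2 - M2 ^+ 2); have := sqr_ge0 `|h|.
  rewrite M4; have := sqr_ge0 M1; have := sqr_ge0 M2.
  move: (`|h| ^+ 2) (M1 ^+ 2) (M2 ^+ 2) h2 => A B C; nra.
have t1 : `|gaussD 0 u - (gaussD 0 x + (gaussD 1 x * h +
    (gaussD 2 x * (h ^+ 2 / 2) + gaussD 3 x * (h ^+ 3 / 6))))|
    <= 64 * `|h| ^+ 4.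
  have := @gauss_taylor 0 4 x h isT.
  rewrite !big_ord_recl big_ord0/= !add0n expr0 expr1 !factS fact0.
  by rewrite !divr1 mulr1 addr0.
have t2 : `|h * (gaussD 1 u - (gaussD 1 x + (gaussD 2 x * h
    + gaussD 3 x * (h ^+ 2 / 2))))| <= 64 * `|h| ^+ 4.
  rewrite normrM [in leRHS]exprS [leRHS]mulrCA ler_wpM2l//.
  have := @gauss_taylor 1 3 x h isT.
  rewrite !big_ord_recl big_ord0/= expr0 expr1 !factS fact0.
  by rewrite !divr1 mulr1 addr0.
have t3 : `|(a * b) * (gaussD 2 u - (gaussD 2 x + gaussD 3 x * h))|
    <= M1 * M2 * (64 * `|h| ^+ 2).
  rewrite normrM; apply: ler_pM => //; first by rewrite normrM ler_pM.
  have := @gauss_taylor 2 2 x h isT.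
  rewrite !big_ord_recl big_ord0/= expr0 expr1 !factS fact0.
  by rewrite !divr1 mulr1 addr0.
have t4 : `|(gaussD 1 u - gaussD 1 x) * (s - r)| <= 64 * (M1 + M2) * (L2 + L1).
  rewrite normrM; apply: ler_pM => //.
    have := @gauss_taylor 1 1 x h isT.
    rewrite big_ord_recl big_ord0/= expr0 fact0 divr1 mulr1 addr0 expr1.
    by move/le_trans; apply; rewrite ler_wpM2l.
  by apply: le_trans (ler_normB _ _) _; exact: lerD.
have t5 : `|gaussD 2 u * (r * s - (r * b + a * s))| <=
    64 * (L1 * L2 + (L1 * M2 + M1 * L2)).
  rewrite normrM; apply: ler_pM => //; first exact: normr_gaussD_le.
  apply: le_trans (ler_normB _ _) _; rewrite normrM lerD// ?ler_pM//.
  by apply: le_trans (ler_normD _ _) _; rewrite !normrM lerD// ler_pM.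
have -> : gammaD u (r - a) (s - b) - gammaD_expansion x a b r s =
    gaussD 0 u - (gaussD 0 x + (gaussD 1 x * h + (gaussD 2 x * (h ^+ 2 / 2)
      + gaussD 3 x * (h ^+ 3 / 6))))
    - h * (gaussD 1 u - (gaussD 1 x + (gaussD 2 x * h
      + gaussD 3 x * (h ^+ 2 / 2))))
    - (a * b) * (gaussD 2 u - (gaussD 2 x + gaussD 3 x * h))
    - (gaussD 1 u - gaussD 1 x) * (s - r)
    - gaussD 2 u * (r * s - (r * b + a * s)).
  by rewrite /gammaD /gammaD_expansion /h; field.
apply: le_trans (ler_normB _ _) _.
apply: le_trans (lerD (ler_normB _ _) (lexx _)) _.
apply: le_trans (lerD (lerD (ler_normB _ _) (lexx _)) (lexx _)) _.
apply: le_trans (lerD (lerD (lerD (ler_normB _ _) (lexx _))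
  (lexx _)) (lexx _)) _.
apply: le_trans (lerD (lerD (lerD (lerD t1 t2) t3) t4) t5) _.
have M12 : M1 * M2 * (64 * `|h| ^+ 2) <= 128 * (M1 ^+ 4 + M2 ^+ 4).
  apply: (@le_trans _ _ ((M1 ^+ 2 + M2 ^+ 2) / 2 *
    (128 * (M1 ^+ 2 + M2 ^+ 2)))).
    apply: ler_pM; rewrite ?mulr_ge0 ?exprn_ge0//.
      by have := sqr_ge0 (M1 - M2); nra.
    lra.
  rewrite M4; have := sqr_ge0 (M1 ^+ 2 - M2 ^+ 2).
  move: (M1 ^+ 2) (M2 ^+ 2) => A B; nra.
have := mulr_ge0 L10 M10; have := mulr_ge0 L10 M20; have := mulr_ge0 L20 M10.
have := mulr_ge0 L20 M20; have := mulr_ge0 L10 L20.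
have := exprn_ge0 4 M10; have := exprn_ge0 4 M20.
lra.
Qed.

End gauss.

(** * Bounded measurable functions *)

Section bounded_measurable.
Variable R : realType.

(** Such functions form an algebra and are integrable for every measure of mass one, so that their
    real-valued integrals are linear. *)
Definition bmfun d (T : measurableType d) (f : T -> R) : Prop :=
  measurable_fun [set: T] f /\ exists c : R, forall x, `|f x| <= c.

Section closure.
Context d (T : measurableType d).
Implicit Types f g : T -> R.

Lemma bmfun_cst (c : R) : bmfun (fun _ : T => c).
Proof. by split; [exact: measurable_cst | exists `|c|]. Qed.

Lemma bmfunN f : bmfun f -> bmfun (fun x => - f x).
Proof.
move=> [mf [c fc]]; split; first exact: measurable_funN.
by exists c => x; rewrite normrN.
Qed.

Lemma bmfunD f g : bmfun f -> bmfun g -> bmfun (fun x => f x + g x).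
Proof.
move=> [mf [c fc]] [mg [e ge]]; split; first exact: measurable_funD.
by exists (c + e) => x; rewrite (le_trans (ler_normD _ _))// lerD.
Qed.

Lemma bmfunB f g : bmfun f -> bmfun g -> bmfun (fun x => f x - g x).
Proof. by move=> hf hg; apply: bmfunD => //; exact: bmfunN. Qed.

Lemma bmfunM f g : bmfun f -> bmfun g -> bmfun (fun x => f x * g x).
Proof.
move=> [mf [c fc]] [mg [e ge]]; split; first exact: measurable_funM.
by exists (c * e) => x; rewrite normrM ler_pM.
Qed.

Lemma bmfunX n f : bmfun f -> bmfun (fun x => f x ^+ n).
Proof.
move=> hf; elim: n => [|n IH]; first exact: bmfun_cst.
by under eq_fun do rewrite exprS; exact: bmfunM.
Qed.

Lemma bmfun_norm f : bmfun f -> bmfun (fun x => `|f x|).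
Proof.
move=> [mf [c fc]]; split; first exact: measurableT_comp.
by exists c => x; rewrite normr_id.
Qed.

Lemma bmfun_max f g : bmfun f -> bmfun g ->
  bmfun (fun x => Num.max (f x) (g x)).
Proof.
move=> [mf [c fc]] [mg [e ge]]; split; first exact: measurable_maxr.
exists (c + e) => x; rewrite maxEle; case: ifP => _.
  by rewrite (le_trans (ge x))// lerDr (le_trans _ (fc x)).
by rewrite (le_trans (fc x))// lerDl (le_trans _ (ge x)).
Qed.

Lemma bmfun_indic (A : set T) : measurable A -> bmfun (\1_A : T -> R).
Proof.
move=> mA; split; first exact: measurable_indic.
by exists 1 => x; rewrite indicE; case: (_ \in _); rewrite ?normr1 ?normr0.
Qed.

Lemma bmfun_comp d' (T' : measurableType d') (h : T' -> T) f :
  measurable_fun [set: T'] h -> bmfun f -> bmfun (fun x => f (h x)).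
Proof.
move=> mh [mf [c fc]]; split; first exact: (measurableT_comp mf mh).
by exists c => x.
Qed.

(** Here [f] may be unbounded, as for [y |-> gaussD k (c - y)] on the real line. *)
Lemma bmfun_gaussD_comp k f :
  measurable_fun [set: T] f -> bmfun (fun x => gaussD k (f x)).
Proof.
move=> mf; split; first exact: (measurableT_comp (@measurable_gaussD R k) mf).
by exists 64 => x; exact: normr_gaussD_le.
Qed.

Lemma bmfun_gaussD k f : bmfun f -> bmfun (fun x => gaussD k (f x)).
Proof. by case=> mf _; exact: bmfun_gaussD_comp. Qed.

(* Subtracting [(c / 2) * sgn f], a combination of indicators, from a function
   bounded by [c] halves the bound and does not change [Lam]. *)
Lemma bmfun_functional_eq0 (Lam : (T -> R) -> R) (K : R) :
  (forall f A c, bmfun f -> measurable A ->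
    Lam (fun x => f x + c * \1_A x) = Lam f) ->
  (forall f c, bmfun f -> (forall x, `|f x| <= c) -> `|Lam f| <= K * c) ->
  forall f, bmfun f -> Lam f = 0.
Proof.
move=> Lam_indic Lam_bounded.
have halve n f c : bmfun f -> (forall x, `|f x| <= c) ->
    `|Lam f| <= K * (c / 2 ^+ n).
  elim: n f c => [|n IH] f c hf fc.
    by rewrite expr0 divr1; exact: Lam_bounded.
  pose A := f @^-1` `[0, +oo[%classic.
  have mA : measurable A.
    by rewrite -[A]setTI; apply: hf.1 => //; exact: measurable_itv.
  (* This is [f - c / 2] where [f >= 0] and [f + c / 2] elsewhere; the constant is written as a
     multiple of the indicator of the whole space so that [Lam_indic] applies. *)
  have hs : bmfun (fun x => f x + (c / 2) * \1_[set: T] x + (- c) * \1_A x).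
    by repeat first [apply: bmfunD|apply: bmfunM|exact: bmfun_cst
      |exact: bmfun_indic|exact: hf].
  rewrite -(Lam_indic _ setT (c / 2) hf measurableT) -(Lam_indic _ A (- c))//;
    last first.
    by repeat first [apply: bmfunD|apply: bmfunM|exact: bmfun_cst
      |exact: bmfun_indic|exact: hf].
  have -> : c / 2 ^+ n.+1 = (c / 2) / 2 ^+ n by rewrite exprS invfM mulrA.
  apply: IH => // x; have := fc x.
  rewrite !indicE in_setT mulr1 ler_norml => /andP[f1 f2].
  rewrite (_ : (x \in A) = (0 <= f x)); last first.
    by apply/idP/idP; rewrite inE /A/= in_itv/= andbT.
  rewrite ler_norml; case: (leP 0 (f x)) => f0; rewrite ?mulr1n ?mulr0n;
    apply/andP; split; lra.
move=> f hf; have [c fc] := hf.2; apply/eqP; rewrite -normr_le0.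
have c0 : 0 <= K * c by apply: le_trans (Lam_bounded _ _ hf fc).
(* Any n > K c / e brings K c / 2^n below e, because 2^n > n. *)
apply/ler_addgt0Pl => e e0; rewrite addr0.
have [n ne] : exists n : nat, K * c / e < n%:R.
  have /archi_boundP := divr_ge0 c0 (ltW e0).
  by exists (Num.bound (K * c / e)).
apply: le_trans (halve n _ _ hf fc) _; rewrite mulrA ler_pdivrMr ?exprn_gt0//.
rewrite ltr_pdivrMr// in ne; apply: ltW; apply: lt_le_trans ne _.
rewrite mulrC ler_pM2l//.
by rewrite -natrX ler_nat ltnW// ltn_expl.
Qed.
End closure.

Section expectation.
Context d (T : measurableType d) (mu : {measure set T -> \bar R}).
Hypothesis mu1 : mu [set: T] = 1%E.
Implicit Types f g : T -> R.

Lemma bmfun_integrable f : bmfun f -> mu.-integrable [set: T] (EFin \o f).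
Proof.
move=> [mf [c fc]]; apply: measurable_bounded_integrable => //.
  by rewrite mu1 ltry.
exists c; split; first exact: num_real.
by move=> x cx y _; apply: le_trans (fc y) (ltW cx).
Qed.

Lemma bmfun_RintegralD f g : bmfun f -> bmfun g ->
  \int[mu]_x (f x + g x) = \int[mu]_x f x + \int[mu]_x g x.
Proof. by move=> hf hg; rewrite RintegralD//; exact: bmfun_integrable. Qed.

Lemma bmfun_RintegralB f g : bmfun f -> bmfun g ->
  \int[mu]_x (f x - g x) = \int[mu]_x f x - \int[mu]_x g x.
Proof. by move=> hf hg; rewrite RintegralB//; exact: bmfun_integrable. Qed.

Lemma bmfun_RintegralZl c f : bmfun f ->
  \int[mu]_x (c * f x) = c * \int[mu]_x f x.
Proof. by move=> hf; rewrite RintegralZl//; exact: bmfun_integrable. Qed.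

Lemma bmfun_le_Rintegral f g : bmfun f -> bmfun g -> (forall x, f x <= g x) ->
  \int[mu]_x f x <= \int[mu]_x g x.
Proof.
by move=> hf hg fg; apply: le_Rintegral => //; exact: bmfun_integrable.
Qed.

Lemma Rintegral_cst1 (c : R) : \int[mu]_x c = c.
Proof. by rewrite Rintegral_cst// mu1 mulr1. Qed.

Lemma bmfun_normr_Rintegral_le f g : bmfun f -> bmfun g ->
  (forall x, `|f x| <= g x) -> `|\int[mu]_x f x| <= \int[mu]_x g x.
Proof.
move=> hf hg fg; apply: le_trans (le_normr_Rintegral _ _) _ => //.
  exact: bmfun_integrable.
by apply: bmfun_le_Rintegral => //; exact: bmfun_norm.
Qed.

Lemma bmfun_normr_Rintegral_le_cst f c : bmfun f ->
  (forall x, `|f x| <= c) -> `|\int[mu]_x f x| <= c.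
Proof.
move=> hf fc; rewrite -[leRHS]Rintegral_cst1.
by apply: bmfun_normr_Rintegral_le => //; exact: bmfun_cst.
Qed.

Lemma bmfun_Rintegral_fineK f : bmfun f ->
  (\int[mu]_x f x)%:E = (\int[mu]_x (f x)%:E)%E.
Proof.
by move=> hf; rewrite fineK//; apply: integrable_fin_num => //;
  exact: bmfun_integrable.
Qed.

(** The variance of [f] is nonnegative. *)
Lemma Rintegral_sqr_ge f : bmfun f ->
  (\int[mu]_x f x) ^+ 2 <= \int[mu]_x (f x ^+ 2).
Proof.
move=> hf; set m := \int[mu]_x f x.
have : 0 <= \int[mu]_x ((f x - m) ^+ 2).
  by apply: Rintegral_ge0 => x _; exact: sqr_ge0.
have -> : (fun x => (f x - m) ^+ 2) =
    (fun x => f x ^+ 2 - 2 * m * f x + m ^+ 2).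
  by apply/funext => x; ring.
have h1 := bmfunX 2 hf; have h2 := bmfunM (bmfun_cst T (2 * m)) hf.
rewrite bmfun_RintegralD//; [|exact: bmfunB|exact: bmfun_cst].
rewrite bmfun_RintegralB// bmfun_RintegralZl// Rintegral_cst1 -/m; nra.
Qed.

End expectation.

(** * Fubini for bounded functions on a product of probability spaces *)

Section fubini.
Context d1 (T1 : measurableType d1) d2 (T2 : measurableType d2).
Variables (P1 : probability T1 R) (P2 : probability T2 R).
Variable F : T1 * T2 -> R.
Hypothesis hF : bmfun F.

Lemma product_probability_setT : (P1 \x P2)%E [set: T1 * T2] = 1%E.
Proof.
rewrite -setXTT product_measure1E//.
by rewrite [X in (X * _)%E]probability_setT [X in (_ * X)%E]probability_setT
  mule1.
Qed.

Lemma bmfun_pairl x : bmfun (fun y => F (x, y)).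
Proof. by apply: (bmfun_comp (h := pair x)) => //; exact: pair1_measurable. Qed.

Lemma bmfun_pairr y : bmfun (fun x => F (x, y)).
Proof.
by apply: (bmfun_comp (h := fun x => (x, y))) => //; exact: pair2_measurable.
Qed.

Let intF := bmfun_integrable product_probability_setT hF.

Lemma Rintegral_prod1 :
  \int[P1]_x \int[P2]_y F (x, y) = \int[(P1 \x P2)%E]_z F z.
Proof.
rewrite /Rintegral -(integral12_prod_meas1 intF); congr fine.
apply: eq_integral => x _.
exact: (bmfun_Rintegral_fineK (probability_setT P2) (bmfun_pairl _)).
Qed.

Lemma Rintegral_prod2 :
  \int[P2]_y \int[P1]_x F (x, y) = \int[(P1 \x P2)%E]_z F z.
Proof.
rewrite /Rintegral -(integral21_prod_meas1 intF); congr fine.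
apply: eq_integral => y _.
exact: (bmfun_Rintegral_fineK (probability_setT P1) (bmfun_pairr _)).
Qed.

End fubini.
End bounded_measurable.

(** * Conditional distributions *)

Ltac solve_bmfun := repeat first [ assumption | lazymatch goal with
  | |- bmfun (fun z => gaussD _ (@?f z)) => apply: bmfun_gaussD
  | |- bmfun (fun z => @?f z - @?g z) => apply: (@bmfunB _ _ _ f g)
  | |- bmfun (fun z => @?f z + @?g z) => apply: (@bmfunD _ _ _ f g)
  | |- bmfun (fun z => - @?f z) => apply: (@bmfunN _ _ _ f)
  | |- bmfun (fun z => @?f z * @?g z) => apply: (@bmfunM _ _ _ f g)
  | |- bmfun (fun z => @?f z ^+ _) => apply: (@bmfunX _ _ _ _ f)
  | |- _ => exact: bmfun_cst
  end ].

Section conditional.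
Context (R : realType) d (O : measurableType d) (P : probability O R).

Section kernel.
Context d' (X : measurableType d') (k : R.-pker X ~> O).

(** Adding a bound [c] of [f] makes the integrand nonnegative, as [measurable_fun_integral_kernel]
    requires; the kernel having mass one, this adds exactly [c] to the integral. *)
Lemma bmfun_kernel_integral (f : O -> R) : bmfun f ->
  bmfun (fun x => \int[k x]_o f o).
Proof.
move=> hf; have [mf [c fc]] := hf; split; last first.
  exists c => x; apply: bmfun_normr_Rintegral_le_cst => //.
  exact: prob_kernel.
have -> : (fun x => \int[k x]_o f o) = (fun x => \int[k x]_o (f o + c) - c).
  apply/funext => x; have kx1 := @prob_kernel _ _ _ _ _ k x.
  by rewrite bmfun_RintegralD// ?Rintegral_cst1// ?addrK//; exact: bmfun_cst.
apply: measurable_funB; last exact: measurable_cst.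
apply: (measurableT_comp (@fine_measurable R setT measurableT)).
apply: measurable_fun_integral_kernel.
- by move=> U mU; exact: measurable_kernel.
- by move=> o; rewrite lee_fin -lerBlDr sub0r; have := fc o;
    rewrite ler_norml => /andP[].
- apply/measurable_EFinP; apply: measurable_funD => //; exact: measurable_cst.
Qed.

(** [is_cond_dist] gives the case of indicators, and [bmfun_functional_eq0] extends it to bounded
    [f]; the constant is 2 because [f] minus its conditional mean is at most twice a bound of
    [f]. *)
Lemma cond_dist_Rintegral (XT : O -> X) (f : O -> R) (B : set X) :
  measurable_fun [set: O] XT -> is_cond_dist P XT k ->
  bmfun f -> measurable B ->
  \int[P]_o ((f o - \int[k (XT o)]_o1 f o1) * \1_(XT @^-1` B) o) = 0.
Proof.
move=> mX kP hf mB.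
have P1 : P [set: O] = 1%E := probability_setT P.
have k1 x : k x [set: O] = 1%E := @prob_kernel _ _ _ _ _ k x.
have mXB : measurable (XT @^-1` B).
  by rewrite -[X in measurable X]setTI; exact: mX.
have hB := @bmfun_indic R _ _ _ mXB.
have hk (g : O -> R) : bmfun g -> bmfun (fun o => \int[k (XT o)]_o1 g o1).
  by move=> hg; exact: (bmfun_comp mX (bmfun_kernel_integral hg)).
pose Lam (g : O -> R) :=
  \int[P]_o ((g o - \int[k (XT o)]_o1 g o1) * \1_(XT @^-1` B) o).
apply: (@bmfun_functional_eq0 R _ _ Lam 2) hf => [{}f A c hf mA|{}f c hf fc].
- have hA := @bmfun_indic R _ _ _ mA.
  have A0 : \int[P]_o ((\1_A o - \int[k (XT o)]_o1 \1_A o1) *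
      \1_(XT @^-1` B) o) = 0.
    under eq_fun do rewrite mulrBl.
    have hkA := hk _ hA.
    rewrite bmfun_RintegralB//; [|exact: bmfunM..].
    apply/eqP; rewrite subr_eq0; apply/eqP; rewrite /Rintegral; congr fine.
    have -> : (\int[P]_x (\1_A x * \1_(XT @^-1` B) x)%:E =
        P (A `&` XT @^-1` B))%E.
      rewrite -[A `&` _]setIT -integral_indic//; last exact: measurableI.
      by apply: eq_integral => o _; rewrite indicI.
    rewrite kP// [LHS]integral_mkcond; apply: eq_integral => o _.
    have kA : (k (XT o) A <= 1)%E.
      by rewrite -(k1 (XT o)); apply: le_measure; rewrite ?inE.
    rewrite patchE -(@fineK _ (k (XT o) A)); last first.
      by rewrite ge0_fin_numE// (le_lt_trans kA)// ltry.
    rewrite integral_indic// setIT indicE; case: ifP => _.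
      by rewrite mulr1.
    by rewrite mulr0.
  rewrite -[RHS]addr0 -[X in _ = _ + X](mulr0 c) -[in RHS]A0 /Lam.
  have hkA := hk _ hA; have hkf := hk _ hf.
  rewrite -bmfun_RintegralZl//; last by solve_bmfun.
  rewrite -bmfun_RintegralD//; [|by solve_bmfun..].
  apply: eq_Rintegral => o _.
  rewrite bmfun_RintegralD//; last by solve_bmfun.
  rewrite bmfun_RintegralZl//; ring.
- have hkf := hk _ hf.
  apply: bmfun_normr_Rintegral_le_cst => //; first by solve_bmfun.
  move=> o; have c0 : 0 <= c by apply: le_trans (fc o).
  rewrite normrM indicE.
  have H : `|f o - \int[k (XT o)]_o1 f o1| <= 2 * c.
    apply: le_trans (ler_normB _ _) _; rewrite mulr_natl mulr2n lerD//.
    exact: bmfun_normr_Rintegral_le_cst.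
  case: (_ \in _); first by rewrite normr1 mulr1.
  by rewrite normr0 mulr0 mulr_ge0.
Qed.

End kernel.

(** Again [bmfun_functional_eq0], now as a functional of [g], with a bound of [Z] as constant. *)
Lemma Rintegral_orthogonal_comp (Z t : O -> R) (g : R -> R) :
  bmfun Z -> measurable_fun [set: O] t ->
  (forall Y, measurable Y -> \int[P]_o (Z o * \1_(t @^-1` Y) o) = 0) ->
  bmfun g -> \int[P]_o (Z o * g (t o)) = 0.
Proof.
move=> hZ mt Z0 hg; have P1 : P [set: O] = 1%E := probability_setT P.
have [K ZK] := hZ.2.
have ht (f : R -> R) : bmfun f -> bmfun (fun o => f (t o)).
  by move=> hf; exact: (bmfun_comp mt hf).
pose Lam (f : R -> R) := \int[P]_o (Z o * f (t o)).
apply: (@bmfun_functional_eq0 R _ _ Lam K) hg => [f A c hf mA|f c hf fc].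
- have hA := ht _ (@bmfun_indic R _ _ _ mA); have {}hf := ht _ hf.
  rewrite -[RHS]addr0 -[X in _ = _ + X](mulr0 c) -[in RHS](Z0 _ mA) /Lam.
  rewrite -bmfun_RintegralZl//; last by solve_bmfun.
  rewrite -bmfun_RintegralD//; [|by solve_bmfun..].
  apply: eq_Rintegral => o _.
  have -> : (\1_(t @^-1` A) o : R) = \1_A (t o) by [].
  by ring.
- have {}hf := ht _ hf.
  apply: bmfun_normr_Rintegral_le_cst => //; first by solve_bmfun.
  by move=> o; rewrite normrM ler_pM.
Qed.

(** [gammaD] is affine in [d1] and in [d2] separately. With the first observation fixed, the
    coefficient of [d2] depends on the second one through [t2] alone, and symmetrically for [d1]. *)
Lemma Rintegral_gammaD_replace (t1 t2 D1 D2 e1 e2 : O -> R) :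
  bmfun t1 -> bmfun t2 -> bmfun D1 -> bmfun D2 -> bmfun e1 -> bmfun e2 ->
  (forall g : R -> R, bmfun g ->
    \int[P]_o (D1 o * g (t1 o)) = \int[P]_o (e1 o * g (t1 o))) ->
  (forall g : R -> R, bmfun g ->
    \int[P]_o (D2 o * g (t2 o)) = \int[P]_o (e2 o * g (t2 o))) ->
  \int[P]_o1 \int[P]_o2 gammaD (t1 o1 - t2 o2) (D1 o1) (D2 o2) =
  \int[P]_o1 \int[P]_o2 gammaD (t1 o1 - t2 o2) (e1 o1) (e2 o2).
Proof.
move=> ht1 ht2 hD1 hD2 he1 he2 H1 H2.
have P1 : P [set: O] = 1%E := probability_setT P.
have hfst (f : O -> R) : bmfun f -> bmfun (fun z : O * O => f z.1).
  by move=> hf; exact: (bmfun_comp (@measurable_fst _ _ O O) hf).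
have hsnd (f : O -> R) : bmfun f -> bmfun (fun z : O * O => f z.2).
  by move=> hf; exact: (bmfun_comp (@measurable_snd _ _ O O) hf).
have hG (f1 f2 : O -> R) : bmfun f1 -> bmfun f2 ->
    bmfun (fun z : O * O => gammaD (t1 z.1 - t2 z.2) (f1 z.1) (f2 z.2)).
  move=> /hfst hf1 /hsnd hf2; move: ht1 ht2 => /hfst ht1 /hsnd ht2.
  by rewrite /gammaD; solve_bmfun.
have step2 o1 : \int[P]_o2 gammaD (t1 o1 - t2 o2) (D1 o1) (D2 o2) =
    \int[P]_o2 gammaD (t1 o1 - t2 o2) (D1 o1) (e2 o2).
  (* The coefficient of [d2] in [gammaD], with [y] in place of [t2 o2]. *)
  pose g y := - gaussD 1 (t1 o1 - y) - gaussD 2 (t1 o1 - y) * D1 o1.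
  have hg : bmfun g.
    by apply: bmfunB; [apply: bmfunN|apply: bmfunM; last exact: bmfun_cst];
      apply: bmfun_gaussD_comp; exact: measurable_funB.
  have hgt : bmfun (fun o => g (t2 o)) by exact: (bmfun_comp ht2.1 hg).
  have E (f : O -> R) : bmfun f ->
      \int[P]_o2 gammaD (t1 o1 - t2 o2) (D1 o1) (f o2) =
      \int[P]_o2 (gaussD 0 (t1 o1 - t2 o2) + gaussD 1 (t1 o1 - t2 o2) * D1 o1) +
      \int[P]_o2 (f o2 * g (t2 o2)).
    move=> hf; rewrite -bmfun_RintegralD//; [|by solve_bmfun..].
    by apply: eq_Rintegral => o _; rewrite /gammaD /g; ring.
  by rewrite !E// H2.
have step1 o2 : \int[P]_o1 gammaD (t1 o1 - t2 o2) (D1 o1) (e2 o2) =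
    \int[P]_o1 gammaD (t1 o1 - t2 o2) (e1 o1) (e2 o2).
  pose g y := gaussD 1 (y - t2 o2) - gaussD 2 (y - t2 o2) * e2 o2.
  have hg : bmfun g.
    by apply: bmfunB; [|apply: bmfunM; last exact: bmfun_cst];
      apply: bmfun_gaussD_comp; exact: measurable_funB.
  have hgt : bmfun (fun o => g (t1 o)) by exact: (bmfun_comp ht1.1 hg).
  have E (f : O -> R) : bmfun f ->
      \int[P]_o1 gammaD (t1 o1 - t2 o2) (f o1) (e2 o2) =
      \int[P]_o1 (gaussD 0 (t1 o1 - t2 o2) - gaussD 1 (t1 o1 - t2 o2) * e2 o2) +
      \int[P]_o1 (f o1 * g (t1 o1)).
    move=> hf; rewrite -bmfun_RintegralD//; [|by solve_bmfun..].
    by apply: eq_Rintegral => o _; rewrite /gammaD /g; ring.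
  by rewrite !E// H1.
under eq_fun do rewrite step2.
(* The order of integration is exchanged, so that [D1] is replaced with the second observation
   fixed, and then restored. *)
rewrite (Rintegral_prod1 P P (hG _ _ hD1 he2))
  -(Rintegral_prod2 P P (hG _ _ hD1 he2)) /=.
under eq_fun do rewrite step1.
by rewrite (Rintegral_prod2 P P (hG _ _ he1 he2))
  -(Rintegral_prod1 P P (hG _ _ he1 he2)).
Qed.

End conditional.

(** * The class S *)

Section class_S_theory.
Context (R : realType) d (O : measurableType d) (M : set (probability O R))
  (P0 : probability O R) (T : probability O R -> O -> R).
Variable cT : class_S M P0 T.

(** The trace condition fixes [B] only on the range of x^T, which contains every value observed.
    Events about T_P thus become events about x^T, to which conditional distributions apply. *)
Lemma class_S_preimage P (Y : set R) : M P -> measurable Y ->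
  exists2 B, measurable B & T P @^-1` Y = cS_fun cT @^-1` B.
Proof.
move=> MP mY; have [B mB AB] := cS_S1_measurable cT MP mY.
exists B => //; apply/seteqP; split => o /=; rewrite (cS_valE cT o MP) => h.
  have : (range (cS_fun cT) `&` B) (cS_fun cT o).
    by rewrite -AB; split => //; exists o.
  by case.
have : (range (cS_fun cT) `&` cS_val P @^-1` Y) (cS_fun cT o).
  by rewrite AB; split => //; exists o.
by case.
Qed.

(** A bound uniform over the model; the final constant inherits its independence of [P] from it. *)
Lemma class_S_bounded : exists2 K : R, 1 <= K &
  forall P o, M P -> `|T P o| <= K /\ `|cS_D cT P o| <= K.
Proof.
have [b b0 Tb] := cS_S1_bounded cT; have [c Dc] := cS_D_bounded cT.
exists (1 + b + `|c|).
  by rewrite -addrA lerDl addr_ge0.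
move=> P o MP; split; last first.
  by rewrite (le_trans (Dc P o MP))// (le_trans (ler_norm _))// lerDr addr_ge0.
rewrite (cS_valE cT o MP); have : range (cS_fun cT) (cS_fun cT o) by exists o.
move=> /(Tb P _ MP); rewrite -ler_norml => /le_trans; apply.
by rewrite -addrA addrCA lerDl addr_ge0.
Qed.

Lemma bmfun_class_S P : M P -> bmfun (T P).
Proof.
move=> MP; split.
  move=> _ Y mY; rewrite setTI; have [B mB ->] := class_S_preimage MP mY.
  by rewrite -[X in measurable X]setTI; exact: cS_fun_measurable.
by have [K _ TK] := class_S_bounded; exists K => o; case: (TK P o MP).
Qed.

Lemma bmfun_class_S_D P : M P -> bmfun (cS_D cT P).
Proof.
move=> MP; split; first exact: cS_D_measurable.
by have [c Dc] := cS_D_bounded cT; exists c => o; exact: Dc.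
Qed.

Lemma bmfun_class_S_cond P Q : M P -> M Q ->
  bmfun (fun o => \int[cS_cond cT Q (cS_fun cT o)]_o1 cS_D cT P o1).
Proof.
move=> MP MQ; exact: (bmfun_comp (cS_fun_measurable (c := cT))
  (bmfun_kernel_integral (cS_cond cT Q) (bmfun_class_S_D MP))).
Qed.

Hypothesis MP0 : M P0.

Lemma bmfun_Rem P : M P -> bmfun (Rem cT P).
Proof.
move=> MP; rewrite /Rem.
have h1 := bmfun_class_S MP; have h0 := bmfun_class_S MP0.
have c1 := bmfun_class_S_cond MP MP; have c0 := bmfun_class_S_cond MP MP0.
by solve_bmfun.
Qed.

Lemma Rem_bounded : exists2 K : R, 1 <= K & forall P o, M P ->
  `|Rem cT P o| <= K /\ `|T P o - T P0 o| <= K.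
Proof.
(* Twice [K] for T_P - T_0, and [K] for each of the two conditional means. *)
have [K K1 HK] := class_S_bounded; exists (4 * K).
  by lra.
move=> P o MP; have [T1 _] := HK P o MP; have [T0 _] := HK P0 o MP0.
have T10 : `|T P o - T P0 o| <= 2 * K.
  by apply: le_trans (ler_normB _ _) _; rewrite mulr_natl mulr2n lerD.
split; last by apply: le_trans T10 _; lra.
have kK Q : `|\int[cS_cond cT Q (cS_fun cT o)]_o1 cS_D cT P o1| <= K.
  apply: bmfun_normr_Rintegral_le_cst; first exact: prob_kernel.
    exact: bmfun_class_S_D.
  by move=> o1; case: (HK P o1 MP).
apply: le_trans (ler_normD _ _) _.
apply: le_trans (lerD T10 (ler_normB _ _)) _.
by have := kK P0; have := kK P; lra.
Qed.

(* The conditional mean of [cS_D P] given x^T under [P0] is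
   [Rem - (T P - T P0)], its conditional mean under [P] being null. *)
Lemma Rintegral_D_Rem P (g : R -> R) : M P -> bmfun g ->
  \int[P0]_o (cS_D cT P o * g (T P o)) =
  \int[P0]_o ((Rem cT P o - (T P o - T P0 o)) * g (T P o)).
Proof.
move=> MP hg; have P1 : P0 [set: O] = 1%E := probability_setT P0.
have hT := bmfun_class_S MP; have hD := bmfun_class_S_D MP.
have h0 := bmfun_class_S_cond MP MP0; have h1 := bmfun_class_S_cond MP MP.
have hgT : bmfun (fun o => g (T P o)) by exact: (bmfun_comp hT.1 hg).
pose k0 o := \int[cS_cond cT P0 (cS_fun cT o)]_o1 cS_D cT P o1.
pose k1 o := \int[cS_cond cT P (cS_fun cT o)]_o1 cS_D cT P o1.
have ortho : \int[P0]_o ((cS_D cT P o - k0 o) * g (T P o)) = 0.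
  apply: Rintegral_orthogonal_comp => //; [by solve_bmfun|exact: hT.1|].
  move=> Y mY; have [B mB ->] := class_S_preimage MP mY.
  apply: cond_dist_Rintegral => //; first exact: cS_fun_measurable.
  exact: cS_condP.
(* The conditional mean under [P] vanishes almost everywhere for [P0], the measure integrated
   here. *)
have null : \int[P0]_o (k1 o * g (T P o)) = 0.
  rewrite /Rintegral (ae_eq_integral (cst 0%E))//.
  - by rewrite integral0.
  - by apply/measurable_EFinP; exact: (bmfunM h1 hgT).1.
  - apply: filterS (cS_S3_center cT MP) => o k1o _.
    by rewrite /k1 k1o mul0r.
transitivity (\int[P0]_o ((cS_D cT P o - k0 o) * g (T P o) + k0 o * g (T P o))).
  by apply: eq_Rintegral => o _; ring.
rewrite bmfun_RintegralD//; [|by solve_bmfun..].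
rewrite ortho add0r -[LHS]subr0 -null -bmfun_RintegralB//; [|by solve_bmfun..].
by apply: eq_Rintegral => o _; rewrite /Rem /k0 /k1; ring.
Qed.

End class_S_theory.

Lemma Gamma2E (R : realType) d (O : measurableType d)
    (M : set (probability O R)) (P0 : probability O R)
    (T U : probability O R -> O -> R) (cT : class_S M P0 T)
    (cU : class_S M P0 U) P o1 o2 :
  Gamma2 cT cU P o1 o2 =
  gammaD (T P o1 - U P o2) (cS_D cT P o1) (cS_D cU P o2).
Proof. by rewrite /Gamma2 /gammaD /gaussD; ring. Qed.

(** * Norms *)

Section norms.
Context (R : realType) d (O : measurableType d) (P : probability O R).

Lemma norm_p_nat (n : nat) (f : O -> R) : (0 < n)%N -> bmfun f ->
  (forall o, 0 <= f o) ->
  exists2 r : R, norm_p P n%:R f = r%:E &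
    0 <= r /\ r ^+ n = \int[P]_o (f o ^+ n).
Proof.
move=> n0 hf f0; have P1 : P [set: O] = 1%E := probability_setT P.
have hfn := bmfunX n hf.
have I0 : 0 <= \int[P]_o (f o ^+ n).
  by apply: Rintegral_ge0 => o _; exact: exprn_ge0.
exists ((\int[P]_o (f o ^+ n)) `^ n%:R^-1); last first.
  split; first exact: powR_ge0.
  by rewrite -powR_mulrn ?powR_ge0// -powRrM mulVf ?pnatr_eq0 ?gt_eqF// powRr1.
rewrite /norm_p unlock.
have -> : (\int[P]_x (`|(EFin \o f) x| `^ n%:R) = (\int[P]_o (f o ^+ n))%:E)%E.
  rewrite bmfun_Rintegral_fineK//; apply: eq_integral => o _ /=.
  by rewrite ger0_norm// powR_mulrn.
by rewrite poweR_EFin.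
Qed.

(** Hoelder's inequality with exponents 2 and 2; the 1-norm of the product is its integral by
    nonnegativity. *)
Lemma Rintegral_cauchy_schwarz (f g : O -> R) (rf rg : R) :
  bmfun f -> bmfun g -> (forall o, 0 <= f o) -> (forall o, 0 <= g o) ->
  norm_p P 2 f = rf%:E -> norm_p P 2 g = rg%:E ->
  \int[P]_o (f o * g o) <= rf * rg.
Proof.
move=> hf hg f0 g0 Ef Eg; have hfg := bmfunM hf hg.
have [r Er [_]] := @norm_p_nat 1 _ isT hfg (fun o => mulr_ge0 (f0 o) (g0 o)).
rewrite expr1 => rE.
have := @hoelder _ _ R P f g 2 2 hf.1 hg.1.
have -> : (2^-1 + 2^-1 = 1 :> R) by field.
move=> /(_ _ _ erefl); rewrite !ltr0n => /(_ isT isT).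
rewrite -[X in (X <= _ * _)%E -> _]/(norm_p P 1 _).
rewrite -[X in (_ <= X * _)%E -> _]/(norm_p P 2 _).
rewrite -[X in (_ <= _ * X)%E -> _]/(norm_p P 2 _).
by rewrite Er Ef Eg -EFinM lee_fin rE.
Qed.

End norms.

(** * The remainder *)

Section product_square.
Context (R : realType) d (O : measurableType d) (P : probability O R).
Let P1 : P [set: O] = 1%E := probability_setT P.

Lemma bmfun_fst (f : O -> R) : bmfun f -> bmfun (fun z : O * O => f z.1).
Proof. by move=> hf; exact: (bmfun_comp (@measurable_fst _ _ O O) hf). Qed.

Lemma bmfun_snd (f : O -> R) : bmfun f -> bmfun (fun z : O * O => f z.2).
Proof. by move=> hf; exact: (bmfun_comp (@measurable_snd _ _ O O) hf). Qed.

Lemma Rintegral_prodM (f g : O -> R) : bmfun f -> bmfun g ->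
  \int[(P \x P)%E]_z (f z.1 * g z.2) = (\int[P]_o f o) * (\int[P]_o g o).
Proof.
move=> hf hg; have h := bmfunM (bmfun_fst hf) (bmfun_snd hg).
rewrite -(Rintegral_prod1 P P h) /=.
under eq_fun do rewrite bmfun_RintegralZl//.
rewrite mulrC -bmfun_RintegralZl//.
by apply: eq_Rintegral => o _; rewrite mulrC.
Qed.

Lemma Rintegral_fst (f : O -> R) : bmfun f ->
  \int[(P \x P)%E]_z f z.1 = \int[P]_o f o.
Proof.
move=> hf; rewrite -(Rintegral_prod1 P P (bmfun_fst hf)) /=.
by under eq_fun do rewrite Rintegral_cst1//.
Qed.

Lemma Rintegral_snd (f : O -> R) : bmfun f ->
  \int[(P \x P)%E]_z f z.2 = \int[P]_o f o.
Proof.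
move=> hf; rewrite -(Rintegral_prod2 P P (bmfun_snd hf)) /=.
by under eq_fun do rewrite Rintegral_cst1//.
Qed.

(** Both sides are integrals of [h] against pushforward measures, which coincide. *)
Lemma eq_in_distribution_Rintegral (f g : O -> R) (h : R -> R) :
  bmfun f -> bmfun g -> bmfun h -> eq_in_distribution P f g ->
  \int[P]_o h (f o) = \int[P]_o h (g o).
Proof.
move=> hf hg hh fg; rewrite /Rintegral; congr fine.
have mh : measurable_fun [set: R] (EFin \o h).
  by apply: measurableT_comp => //; exact: hh.1.
have ih (k : O -> R) : bmfun k ->
    P.-integrable (k @^-1` setT) ((EFin \o h) \o k).
  by move=> hk; rewrite preimage_setT;
    apply: (bmfun_integrable P1 (bmfun_comp hk.1 hh)).
have := integral_pushforward hf.1 mh (ih _ hf) measurableT.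
have := integral_pushforward hg.1 mh (ih _ hg) measurableT.
rewrite !preimage_setT => <- <-.
apply: eq_measure_integral; [exact: hg.1|exact: hf.1|].
move=> ? ? A mA _; exact: fg.
Qed.

(** By Fubini it is enough to fix the first observation, on which [F] may depend arbitrarily; then
    only the laws of [f] and [g] matter. *)
Lemma eq_in_distribution_snd (f g : O -> R) (F : O -> R -> R) :
  bmfun f -> bmfun g -> eq_in_distribution P f g -> (forall o, bmfun (F o)) ->
  bmfun (fun z : O * O => F z.1 (f z.2)) ->
  bmfun (fun z : O * O => F z.1 (g z.2)) ->
  \int[(P \x P)%E]_z F z.1 (f z.2) = \int[(P \x P)%E]_z F z.1 (g z.2).
Proof.
move=> hf hg fg hF hFf hFg.
rewrite -(Rintegral_prod1 P P hFf) -(Rintegral_prod1 P P hFg) /=.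
apply: eq_Rintegral => o _; exact: eq_in_distribution_Rintegral.
Qed.

Lemma eq_in_distribution_fst (f g : O -> R) (F : O -> R -> R) :
  bmfun f -> bmfun g -> eq_in_distribution P f g -> (forall o, bmfun (F o)) ->
  bmfun (fun z : O * O => F z.2 (f z.1)) ->
  bmfun (fun z : O * O => F z.2 (g z.1)) ->
  \int[(P \x P)%E]_z F z.2 (f z.1) = \int[(P \x P)%E]_z F z.2 (g z.1).
Proof.
move=> hf hg fg hF hFf hFg.
rewrite -(Rintegral_prod2 P P hFf) -(Rintegral_prod2 P P hFg) /=.
apply: eq_Rintegral => o _; exact: eq_in_distribution_Rintegral.
Qed.

End product_square.

(** * Integrated gap between one kernel and the Gaussian at [P0] *)

Section gap.
Context (R : realType) d (O : measurableType d) (M : set (probability O R))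
  (P0 : probability O R) (T U : probability O R -> O -> R).
Variables (cT : class_S M P0 T) (cU : class_S M P0 U).
Hypothesis MP0 : M P0.
Variable P : probability O R.
Hypothesis MP : M P.

Let mu1 := product_probability_setT P0 P0.

(** Each D_P is replaced here by Rem_P - (T_P - T_0), its conditional mean under [P0] almost
    everywhere. *)
Definition gap (z : O * O) : R :=
  gammaD (T P z.1 - U P z.2) (Rem cT P z.1 - (T P z.1 - T P0 z.1))
    (Rem cU P z.2 - (U P z.2 - U P0 z.2)) - gaussD 0 (T P0 z.1 - U P0 z.2).

Let hT := bmfun_class_S cT MP.
Let hU := bmfun_class_S cU MP.
Let hT0 := bmfun_class_S cT MP0.
Let hU0 := bmfun_class_S cU MP0.
Let hRT := bmfun_Rem cT MP0 MP.
Let hRU := bmfun_Rem cU MP0 MP.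
Let zT := bmfun_fst hT.
Let zT0 := bmfun_fst hT0.
Let zRT := bmfun_fst hRT.
Let zU := bmfun_snd hU.
Let zU0 := bmfun_snd hU0.
Let zRU := bmfun_snd hRU.

Lemma bmfun_gap : bmfun gap.
Proof. by rewrite /gap /gammaD; solve_bmfun. Qed.

Lemma bmfun_Gamma2 : bmfun (fun z : O * O => Gamma2 cT cU P z.1 z.2).
Proof.
under eq_fun do rewrite Gamma2E.
have zDT := bmfun_fst (bmfun_class_S_D cT MP).
have zDU := bmfun_snd (bmfun_class_S_D cU MP).
by rewrite /gammaD; solve_bmfun.
Qed.

Lemma Phi_prod : Phi T U P0 =
  \int[(P0 \x P0)%E]_z gaussD 0 (T P0 z.1 - U P0 z.2).
Proof.
have h : bmfun (fun z : O * O => gaussD 0 (T P0 z.1 - U P0 z.2)) by solve_bmfun.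
rewrite -(Rintegral_prod1 P0 P0 h) /Phi.
by apply: eq_Rintegral => o1 _; apply: eq_Rintegral => o2 _;
  rewrite /gaussD mul1r.
Qed.

Lemma Rintegral_Gamma2 :
  \int[(P0 \x P0)%E]_z Gamma2 cT cU P z.1 z.2 =
  Phi T U P0 + \int[(P0 \x P0)%E]_z gap z.
Proof.
rewrite -(Rintegral_prod1 P0 P0 bmfun_Gamma2) /=.
pose eT o := Rem cT P o - (T P o - T P0 o).
pose eU o := Rem cU P o - (U P o - U P0 o).
have heT : bmfun eT by rewrite /eT; solve_bmfun.
have heU : bmfun eU by rewrite /eU; solve_bmfun.
transitivity (\int[P0]_o1 \int[P0]_o2
    gammaD (T P o1 - U P o2) (cS_D cT P o1) (cS_D cU P o2)).
  by apply: eq_Rintegral => o1 _; apply: eq_Rintegral => o2 _; rewrite Gamma2E.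
rewrite (@Rintegral_gammaD_replace _ _ _ P0 _ _ _ _ eT eU)//;
  [|exact: bmfun_class_S_D|exact: bmfun_class_S_D
   |by move=> g hg; exact: Rintegral_D_Rem
   |by move=> g hg; exact: Rintegral_D_Rem].
have h : bmfun (fun z : O * O =>
    gammaD (T P z.1 - U P z.2) (eT z.1) (eU z.2)).
  by rewrite /gammaD /eT /eU; solve_bmfun.
have h0 : bmfun (fun z : O * O => gaussD 0 (T P0 z.1 - U P0 z.2)).
  by solve_bmfun.
rewrite (Rintegral_prod1 P0 P0 h) Phi_prod -bmfun_RintegralD//; last first.
  exact: bmfun_gap.
by apply: eq_Rintegral => z _; rewrite /gap /eT /eU; ring.
Qed.

Variables (bL bM : O -> R).
Hypotheses (hL : bmfun bL) (hM : bmfun bM).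
Hypotheses (RTL : forall o, `|Rem cT P o| <= bL o)
  (RUL : forall o, `|Rem cU P o| <= bL o)
  (TM : forall o, `|T P o - T P0 o| <= bM o)
  (UM : forall o, `|U P o - U P0 o| <= bM o).

Let zL1 := bmfun_fst hL.
Let zL2 := bmfun_snd hL.
Let zM1 := bmfun_fst hM.
Let zM2 := bmfun_snd hM.

(** [gammaD_first_order] integrated; each term occurs at both coordinates, which doubles 256 to
    512. *)
Lemma gap_first_order K : 1 <= K ->
  (forall o, bL o <= K) -> (forall o, bM o <= K) ->
  `|\int[(P0 \x P0)%E]_z gap z| <=
    512 * K * (\int[P0]_o bL o + \int[P0]_o (bM o ^+ 2)).
Proof.
move=> K1 LK MK.
pose maj (z : O * O) :=
  256 * K * (bL z.1 + bL z.2 + (bM z.1 ^+ 2 + bM z.2 ^+ 2)).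
have hmaj : bmfun maj by rewrite /maj; solve_bmfun.
apply: le_trans (bmfun_normr_Rintegral_le mu1 bmfun_gap hmaj _) _.
  move=> z; have := gammaD_first_order (T P0 z.1 - U P0 z.2) K1 (RTL z.1)
    (RUL z.2) (TM z.1) (UM z.2) (LK _) (LK _) (MK _) (MK _).
  have -> // : T P0 z.1 - U P0 z.2 +
      (T P z.1 - T P0 z.1 - (U P z.2 - U P0 z.2)) =
    T P z.1 - U P z.2 by ring.
have hM2 := bmfunX 2 hM; have zM21 := bmfun_fst hM2; have zM22 := bmfun_snd hM2.
rewrite /maj bmfun_RintegralZl//; last by solve_bmfun.
rewrite !bmfun_RintegralD//; [|by solve_bmfun..].
rewrite (Rintegral_fst P0 hL) (Rintegral_snd P0 hL).
rewrite (Rintegral_fst P0 hM2) (Rintegral_snd P0 hM2); lra.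
Qed.

(* The terms of the third order expansion of [gap] in which the second (resp.
   first) observation enters only through [U P0] (resp. [T P0]). *)
Definition gap_part_fst (o : O) (y : R) : R :=
  gaussD 1 (T P0 o - y) * Rem cT P o
  - gaussD 2 (T P0 o - y) * ((T P o - T P0 o) ^+ 2 / 2)
  - gaussD 3 (T P0 o - y) * ((T P o - T P0 o) ^+ 3 / 3).

Definition gap_part_snd (o : O) (y : R) : R :=
  gaussD 1 (y - U P0 o) * Rem cU P o
  + gaussD 2 (y - U P0 o) * ((U P o - U P0 o) ^+ 2 / 2)
  - gaussD 3 (y - U P0 o) * ((U P o - U P0 o) ^+ 3 / 3).

Lemma bmfun_gap_part_fst o : bmfun (gap_part_fst o).
Proof.
by rewrite /gap_part_fst; apply: bmfunB; [apply: bmfunB|]; apply: bmfunM;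
  (try exact: bmfun_cst); apply: bmfun_gaussD_comp; exact: measurable_funB.
Qed.

Lemma bmfun_gap_part_snd o : bmfun (gap_part_snd o).
Proof.
by rewrite /gap_part_snd; apply: bmfunB; [apply: bmfunD|]; apply: bmfunM;
  (try exact: bmfun_cst); apply: bmfun_gaussD_comp; exact: measurable_funB.
Qed.

Lemma bmfun_gap_part_fst_prod (f : O -> R) : bmfun f ->
  bmfun (fun z : O * O => gap_part_fst z.1 (f z.2)).
Proof. by move=> /bmfun_snd hf; rewrite /gap_part_fst; solve_bmfun. Qed.

Lemma bmfun_gap_part_snd_prod (f : O -> R) : bmfun f ->
  bmfun (fun z : O * O => gap_part_snd z.2 (f z.1)).
Proof. by move=> /bmfun_fst hf; rewrite /gap_part_snd; solve_bmfun. Qed.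

(** [gammaD_third_order] integrated: terms in one observation occur twice, whence 4096, and products
    across the two observations factorize under the product measure. *)
Lemma gap_third_order :
  `|\int[(P0 \x P0)%E]_z gap z -
    (\int[(P0 \x P0)%E]_z gap_part_fst z.1 (U P0 z.2) -
     \int[(P0 \x P0)%E]_z gap_part_snd z.2 (T P0 z.1))| <=
  4096 * (\int[P0]_o (bL o * bM o) + (\int[P0]_o bL o) * (\int[P0]_o bM o)
    + (\int[P0]_o bL o) ^+ 2 + \int[P0]_o (bM o ^+ 4)).
Proof.
have hp1 := bmfun_gap_part_fst_prod hU0.
have hp2 := bmfun_gap_part_snd_prod hT0.
have hg := bmfun_gap; have hp12 := bmfunB hp1 hp2.
rewrite -!bmfun_RintegralB//.
pose maj (z : O * O) := 2048 * (bL z.1 * bM z.1 + bL z.2 * bM z.2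
  + (bL z.1 * bM z.2 + bM z.1 * bL z.2)
  + bL z.1 * bL z.2 + (bM z.1 ^+ 4 + bM z.2 ^+ 4)).
have hmaj : bmfun maj by rewrite /maj; solve_bmfun.
apply: le_trans (bmfun_normr_Rintegral_le mu1 (bmfunB hg hp12) hmaj _) _.
  move=> z; have := gammaD_third_order (T P0 z.1 - U P0 z.2) (RTL z.1)
    (RUL z.2) (TM z.1) (UM z.2).
  have -> : T P0 z.1 - U P0 z.2 + (T P z.1 - T P0 z.1 - (U P z.2 - U P0 z.2)) =
    T P z.1 - U P z.2 by ring.
  congr (`|_| <= _); last by rewrite /maj; ring.
  by rewrite /gap /gammaD_expansion /gap_part_fst /gap_part_snd; ring.
have hM4 := bmfunX 4 hM; have zM41 := bmfun_fst hM4; have zM42 := bmfun_snd hM4.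
have hLM := bmfunM hL hM; have zLM1 := bmfun_fst hLM.
have zLM2 := bmfun_snd hLM.
rewrite /maj bmfun_RintegralZl//; last by solve_bmfun.
rewrite !bmfun_RintegralD//; [|by solve_bmfun..].
have E1 : \int[(P0 \x P0)%E]_z (bL z.1 * bM z.1) = \int[P0]_o (bL o * bM o).
  exact: (Rintegral_fst P0 hLM).
have E2 : \int[(P0 \x P0)%E]_z (bL z.2 * bM z.2) = \int[P0]_o (bL o * bM o).
  exact: (Rintegral_snd P0 hLM).
have E3 : \int[(P0 \x P0)%E]_z (bM z.1 ^+ 4) = \int[P0]_o (bM o ^+ 4).
  exact: (Rintegral_fst P0 hM4).
have E4 : \int[(P0 \x P0)%E]_z (bM z.2 ^+ 4) = \int[P0]_o (bM o ^+ 4).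
  exact: (Rintegral_snd P0 hM4).
rewrite E1 E2 E3 E4 !Rintegral_prodM//.
have := sqr_ge0 (\int[P0]_o bL o); lra.
Qed.

End gap.

(** The cancellation behind (a): (a - b) - (a - b') - (a' - b) + (a' - b') = 0, so only the four
    errors remain. *)
Lemma signed_sum_le (R : realType) (x1 x2 x3 x4 a a' b b' B : R) :
  `|x1 - (a - b)| <= B -> `|x2 - (a - b')| <= B ->
  `|x3 - (a' - b)| <= B -> `|x4 - (a' - b')| <= B ->
  `|x1 - x2 - x3 + x4| <= 4 * B.
Proof.
rewrite !ler_norml => /andP[? ?] /andP[? ?] /andP[? ?] /andP[? ?].
by apply/andP; split; lra.
Qed.

(** * From the four gaps to the remainder of Psi *)

Section remainder.
Context (R : realType) d (O : measurableType d) (M : set (probability O R))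
  (P0 : probability O R) (Rmap Smap : probability O R -> O -> R).
Variables (cR : class_S M P0 Rmap) (cS : class_S M P0 Smap).
Hypothesis MP0 : M P0.

(** The Gaussian is even and Fubini applies; this merges the two cross terms of Gamma into the -2
    Phi^RS of Psi. *)
Lemma Phi_sym : Phi Smap Rmap P0 = Phi Rmap Smap P0.
Proof.
have hR := bmfun_class_S cR MP0; have hS := bmfun_class_S cS MP0.
have h : bmfun (fun z : O * O => gaussD 0 (Smap P0 z.1 - Rmap P0 z.2)).
  by have h1 := bmfun_fst hS; have h2 := bmfun_snd hR; solve_bmfun.
rewrite (Phi_prod cS cR MP0) -(Rintegral_prod2 P0 P0 h) /Phi /=.
apply: eq_Rintegral => o1 _; apply: eq_Rintegral => o2 _.
by rewrite -gaussD0N opprB /gaussD mul1r.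
Qed.

Section at_P.
Variable P : probability O R.
Hypothesis MP : M P.

(** The Phi parts of the four kernels add up to psi_0, which the remainder subtracts. *)
Lemma Rem_Psi_gap : Rem_Psi cR cS P =
  \int[(P0 \x P0)%E]_z gap cR cR P z - \int[(P0 \x P0)%E]_z gap cR cS P z
  - \int[(P0 \x P0)%E]_z gap cS cR P z + \int[(P0 \x P0)%E]_z gap cS cS P z.
Proof.
have hRR := bmfun_Gamma2 cR cR MP; have hRS := bmfun_Gamma2 cR cS MP.
have hSR := bmfun_Gamma2 cS cR MP; have hSS := bmfun_Gamma2 cS cS MP.
have mu1 := product_probability_setT P0 P0.
have hG : bmfun (fun z : O * O => Gamma cR cS P z.1 z.2).
  by rewrite /Gamma; solve_bmfun.
rewrite /Rem_Psi (Rintegral_prod1 P0 P0 hG) /Gamma.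
rewrite bmfun_RintegralD//; [|by solve_bmfun..].
rewrite [in LHS]bmfun_RintegralB//; [|by solve_bmfun..].
rewrite [in LHS]bmfun_RintegralB//.
rewrite !Rintegral_Gamma2// Phi_sym /Psi.
move: (Phi Rmap Rmap P0) (Phi Rmap Smap P0) (Phi Smap Smap P0) => pRR pRS pSS.
move: (\int[_]_z gap cR cR P z) (\int[_]_z gap cR cS P z) => gRR gRS.
move: (\int[_]_z gap cS cR P z) (\int[_]_z gap cS cS P z) => gSR gSS.
ring.
Qed.

Let hR := bmfun_class_S cR MP.
Let hS := bmfun_class_S cS MP.
Let hR0 := bmfun_class_S cR MP0.
Let hS0 := bmfun_class_S cS MP0.
Let hRR := bmfun_Rem cR MP0 MP.
Let hRS := bmfun_Rem cS MP0 MP.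

Lemma bmfun_L : bmfun (L cR cS P).
Proof. by apply: bmfun_max; exact: bmfun_norm. Qed.

Lemma bmfun_Mdiff : bmfun (Mdiff P0 Rmap Smap P).
Proof. by apply: bmfun_max; apply: bmfun_norm; exact: bmfunB. Qed.

Lemma L_ge0 o : 0 <= L cR cS P o.
Proof. by rewrite le_max normr_ge0. Qed.

Lemma Mdiff_ge0 o : 0 <= Mdiff P0 Rmap Smap P o.
Proof. by rewrite le_max normr_ge0. Qed.

Let RL o : `|Rem cR P o| <= L cR cS P o.
Proof. by rewrite le_max lexx. Qed.

Let SL o : `|Rem cS P o| <= L cR cS P o.
Proof. by rewrite le_max lexx orbT. Qed.

Let RM o : `|Rmap P o - Rmap P0 o| <= Mdiff P0 Rmap Smap P o.
Proof. by rewrite le_max lexx. Qed.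

Let SM o : `|Smap P o - Smap P0 o| <= Mdiff P0 Rmap Smap P o.
Proof. by rewrite le_max lexx orbT. Qed.

Lemma Rem_Psi_first_order K : 1 <= K ->
  (forall o, L cR cS P o <= K) -> (forall o, Mdiff P0 Rmap Smap P o <= K) ->
  `|Rem_Psi cR cS P| <= 2048 * K * (\int[P0]_o L cR cS P o
    + \int[P0]_o (Mdiff P0 Rmap Smap P o ^+ 2)).
Proof.
move=> K1 LK MK; rewrite Rem_Psi_gap.
have hL := bmfun_L; have hM := bmfun_Mdiff.
have := gap_first_order MP0 MP hL hM RL RL RM RM K1 LK MK.
have := gap_first_order MP0 MP hL hM RL SL RM SM K1 LK MK.
have := gap_first_order MP0 MP hL hM SL RL SM RM K1 LK MK.
have := gap_first_order MP0 MP hL hM SL SL SM SM K1 LK MK.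
move: (\int[_]_z gap cR cR P z) (\int[_]_z gap cR cS P z) => gRR gRS.
move: (\int[_]_z gap cS cR P z) (\int[_]_z gap cS cS P z) => gSR gSS.
move: (\int[P0]_o L cR cS P o) (\int[P0]_o (Mdiff P0 Rmap Smap P o ^+ 2)).
move=> iL iM2.
rewrite !ler_norml => /andP[? ?] /andP[? ?] /andP[? ?] /andP[? ?].
apply/andP; split; lra.
Qed.

Lemma Rem_Psi_third_order : eq_in_distribution P0 (Rmap P0) (Smap P0) ->
  `|Rem_Psi cR cS P| <= 4 * (4096 * (
    \int[P0]_o (L cR cS P o * Mdiff P0 Rmap Smap P o)
    + (\int[P0]_o L cR cS P o) * (\int[P0]_o Mdiff P0 Rmap Smap P o)
    + (\int[P0]_o L cR cS P o) ^+ 2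
    + \int[P0]_o (Mdiff P0 Rmap Smap P o ^+ 4))).
Proof.
move=> RS0; rewrite Rem_Psi_gap.
have hL := bmfun_L; have hM := bmfun_Mdiff.
(* Equality in law puts [Rmap P0] in place of [Smap P0], so that the part attached to each mapping
   is the same in both pairs where it occurs, as [signed_sum_le] requires. *)
have gap_part_fst_eq T (cT : class_S M P0 T) :
    \int[(P0 \x P0)%E]_z gap_part_fst cT P z.1 (Smap P0 z.2) =
    \int[(P0 \x P0)%E]_z gap_part_fst cT P z.1 (Rmap P0 z.2).
  apply/esym; apply: eq_in_distribution_snd => //.
  - by move=> o; exact: bmfun_gap_part_fst.
  - exact: bmfun_gap_part_fst_prod.
  - exact: bmfun_gap_part_fst_prod.
have gap_part_snd_eq T (cT : class_S M P0 T) :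
    \int[(P0 \x P0)%E]_z gap_part_snd cT P z.2 (Smap P0 z.1) =
    \int[(P0 \x P0)%E]_z gap_part_snd cT P z.2 (Rmap P0 z.1).
  apply/esym; apply: eq_in_distribution_fst => //.
  - by move=> o; exact: bmfun_gap_part_snd.
  - exact: bmfun_gap_part_snd_prod.
  - exact: bmfun_gap_part_snd_prod.
have conv (g a b a' b' B : R) : a = a' -> b = b' ->
    `|g - (a - b)| <= B -> `|g - (a' - b')| <= B by move=> -> ->.
have tRR := gap_third_order MP0 MP hL hM RL RL RM RM.
have tRS := conv _ _ _ _ _ _ (gap_part_fst_eq _ cR) erefl
  (gap_third_order MP0 MP hL hM RL SL RM SM).
have tSR := conv _ _ _ _ _ _ erefl (gap_part_snd_eq _ cR)
  (gap_third_order MP0 MP hL hM SL RL SM RM).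
have tSS := conv _ _ _ _ _ _ (gap_part_fst_eq _ cS) (gap_part_snd_eq _ cS)
  (gap_third_order MP0 MP hL hM SL SL SM SM).
exact: signed_sum_le tRR tRS tSR tSS.
Qed.

End at_P.
End remainder.

Local Close Scope classical_set_scope.

Theorem theorem3 (R : realType) (d : measure_display) (O : measurableType d)
    (M : set (probability O R)) (P0 : probability O R)
    (Rmap Smap : probability O R -> O -> R)
    (cR : class_S M P0 Rmap) (cS : class_S M P0 Smap)
    (nonparametric_M : nonparametric M) (P0_in_M : M P0) :
  exists2 C : R, 0 < C &
    forall P : probability O R, M P ->
      (eq_in_distribution P0 (Rmap P0) (Smap P0) ->
        (`|Rem_Psi cR cS P|%:E <= C%:E * K0 cR cS P)%E) /\
      (~ eq_in_distribution P0 (Rmap P0) (Smap P0) ->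
        (`|Rem_Psi cR cS P|%:E <= C%:E * K1 cR cS P)%E).
Proof.
have [KR KR1 HR] := Rem_bounded cR P0_in_M.
have [KS KS1 HS] := Rem_bounded cS P0_in_M.
(* One constant for both cases: (a) needs 4 * 4096 * 2 = 4096 * 8, and (b) needs 2048 * (KR +
   KS). *)
exists (4096 * (8 + (KR + KS))); first by lra.
move=> P MP; have P01 : P0 [set: O]%classic = 1%E := probability_setT P0.
have hL := bmfun_L cR cS P0_in_M MP; have hM := bmfun_Mdiff cR cS P0_in_M MP.
have L0 := L_ge0 cR cS P; have M0 := @Mdiff_ge0 _ _ _ P0 Rmap Smap P.
have [l1 El1 [l10]] := @norm_p_nat _ _ _ P0 1 _ isT hL L0.
rewrite (_ : (fun o => L cR cS P o ^+ 1) = L cR cS P)// expr1 => Il1.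
have [l2 El2 [l20 Il2]] := @norm_p_nat _ _ _ P0 2 _ isT hL L0.
have [m2 Em2 [m20 Im2]] := @norm_p_nat _ _ _ P0 2 _ isT hM M0.
have [m4 Em4 [m40 Im4]] := @norm_p_nat _ _ _ P0 4 _ isT hM M0.
split=> RS0.
  have -> : K0 cR cS P = (l2 * m2 + l1 ^+ 2 + m4 ^+ 4)%:E.
    by rewrite /K0 El1 El2 Em2 Em4 !EFinD EFinM !EFin_expe.
  rewrite -EFinM lee_fin.
  apply: le_trans (Rem_Psi_third_order cR cS P0_in_M MP RS0) _.
  have LM := Rintegral_cauchy_schwarz hL hM L0 M0 El2 Em2.
  (* The 1-norm is at most the 2-norm, so the product of the integrals of L and M is bounded by
     [l2 * m2], like the integral of their product; hence the factor 2 below. *)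
  have le_sqrt f r : bmfun f -> 0 <= r -> r ^+ 2 = \int[P0]_o (f o ^+ 2) ->
      (forall o, 0 <= f o) -> 0 <= \int[P0]_o f o <= r.
    move=> hf r0 Ir f0; have I0 : 0 <= \int[P0]_o f o by apply: Rintegral_ge0.
    by rewrite I0 -(@ler_pXn2r _ 2)// Ir; exact: Rintegral_sqr_ge.
  have /andP[L10 L1] := le_sqrt _ _ hL l20 Il2 L0.
  have /andP[M10 M1] := le_sqrt _ _ hM m20 Im2 M0.
  have LM1 := ler_pM L10 M10 L1 M1.
  rewrite -Il1 -Im4 in LM1 *.
  set X := l2 * m2 + l1 ^+ 2 + m4 ^+ 4.
  have X0 : 0 <= X by rewrite !addr_ge0 ?mulr_ge0 ?exprn_ge0.
  apply: (@le_trans _ _ (4 * (4096 * (2 * X)))); last first.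
    have : 0 <= (KR + KS) * X by rewrite mulr_ge0//; lra.
    by clearbody X; clear; lra.
  have l1_ge0 : 0 <= l1 ^+ 2 := sqr_ge0 l1.
  have m4_ge0 : 0 <= m4 ^+ 4 by exact: exprn_ge0.
  by rewrite /X; lra.
have -> : K1 cR cS P = (l1 + m2 ^+ 2)%:E.
  by rewrite /K1 El1 Em2 EFinD EFin_expe.
rewrite -EFinM lee_fin.
(* [KR + KS] bounds both maxima L and M and is at least 1. *)
apply: (@le_trans _ _ (2048 * (KR + KS) * (l1 + m2 ^+ 2))).
  rewrite Il1 Im2; apply: Rem_Psi_first_order => //; first by lra.
  - move=> o; rewrite /L ge_max; have [? _] := HR P o MP.
    have [? _] := HS P o MP.
    by apply/andP; split; lra.
  - move=> o; rewrite /Mdiff ge_max; have [_ ?] := HR P o MP.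
    have [_ ?] := HS P o MP.
    by apply/andP; split; lra.
by rewrite ler_wpM2r ?addr_ge0 ?sqr_ge0//; lra.
Qed.
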